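(* Let $D$ be a CSD-domain. Then $\mathrm{Inv}(D)$ is a free abelian group.
   Context: $\mathrm{Inv}(D)$ is the group of invertible fractional ideals of $D$ under multiplication. A Prüfer domain $D$ is strongly discrete if $P\neq P^2$ for every nonzero prime ideal $P$ of $D$. The inverse topology on the spectrum of a ring $R$ is the topology having as a subbasis of open sets the sets $\mathcal V(I)=\{P\in\mathrm{Spec}(R)\mid I\subseteq P\}$, for $I$ a finitely generated ideal. $\mathrm{Spec}(R)$ is compactly layered if there is a well-ordered sequence $\{Y_\alpha\}_{\alpha<\lambda}$ (indexed by ordinals) of subsets of $\mathrm{Spec}(R)$ such that: $Y_0=\mathrm{Spec}(R)$; $Y_\gamma=\emptyset$ for some $\gamma$; $Y_\alpha\subseteq Y_\beta$ if $\alpha>\beta$; if $\alpha$ is a limit ordinal, $Y_\alpha=\bigcap_{\beta<\alpha}Y_\beta$; each $Y_\alpha$ is closed in the inverse topology; and for every $\alpha$, $Y_\alpha\setminus Y_{\alpha+1}\subseteq\mathrm{Max}(Y_\alpha)$, where $\mathrm{Max}(Y_\alpha)$ is the set of elements of $Y_\alpha$ that are maximal under inclusion. A CSD-domain is a strongly discrete Prüfer domain with compactly layered spectrum. *)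

(* Defs.v *)
From HB Require Import structures.
From mathcomp Require Import all_boot all_order all_algebra.
From mathcomp Require Import boolp classical_sets topology_structure.
From mathcomp Require wochoice.
From mathcomp.multinomials Require Import freeg.

Set Implicit Arguments.
Unset Strict Implicit.
Unset Printing Implicit Defensive.

Import Order.TTheory GRing.Theory.
Local Open Scope ring_scope.
Local Open Scope classical_set_scope.

Section Ideals.
Context {R : comNzRingType}.

Definition ideal_gen (s : seq R) : set R :=
  [set x | exists c : 'I_(size s) -> R, x = \sum_(i < size s) c i * s`_i].

Definition fin_gen_ideal : set (set R) :=
  [set I | exists s : seq R, I = ideal_gen s].

(* The additive closure of the pointwise product: this is the product of
   ideals of R, and also, when R is the fraction field of D, the product of
   fractional ideals of D. *)
Definition prod_ideal (A B : set R) : set R :=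
  [set x | exists2 s : seq (R * R),
     (forall p, p \in s -> A p.1 /\ B p.2) & x = \sum_(p <- s) p.1 * p.2].

End Ideals.

(* The library's prime ideals are proper (their underlying ideals are). *)
Definition Spec (R : comNzRingType) : Type := prime_idealr R.

HB.instance Definition _ (R : comNzRingType) := gen_eqMixin (Spec R).
HB.instance Definition _ (R : comNzRingType) := gen_choiceMixin (Spec R).

Definition ideal_of (R : comNzRingType) (P : Spec R) : set R :=
  [set x | x \in (P : {pred R})].

Definition V_ (R : comNzRingType) (I : set R) : set (Spec R) :=
  [set P | I `<=` ideal_of P].

Definition inverse_topology (R : comNzRingType) : Type := Spec R.

HB.instance Definition _ (R : comNzRingType) := Choice.on (inverse_topology R).
HB.instance Definition _ (R : comNzRingType) :=
  @isSubBaseTopological.Build (inverse_topology R)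
    (set R) (@fin_gen_ideal R) (@V_ R).

Definition Max (R : comNzRingType) (Y : set (Spec R)) : set (Spec R) :=
  [set P | Y P /\ forall Q, Y Q -> ideal_of P `<=` ideal_of Q -> Q = P].

Section Ordinals.
Context {d : Order.disp_t} {W : orderType d}.

Definition is_zero (a : W) : Prop := forall b, (a <= b)%O.

Definition is_succ (a b : W) : Prop := (a < b)%O /\ forall c, (a < c)%O -> (b <= c)%O.

Definition is_limit (a : W) : Prop :=
  ~ is_zero a /\ ~ exists b, is_succ b a.

End Ordinals.

(* An ordinal lambda is represented by a well-ordered type W, whose elements
   stand for the ordinals alpha < lambda. *)
Record layering (R : comNzRingType) (d : Order.disp_t) (W : orderType d)
    (Y : W -> set (Spec R)) : Prop := Layering {
  layering_wo : wochoice.well_order (<=%O : rel W);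
  layering_zero : forall a, is_zero a -> Y a = setT;
  layering_empty : exists c, Y c = set0;
  layering_decr : forall a b, (b < a)%O -> Y a `<=` Y b;
  layering_limit : forall a, is_limit a ->
    Y a = \bigcap_(b in [set b | (b < a)%O]) Y b;
  layering_closed : forall a, closed (Y a : set (inverse_topology R));
  layering_max : forall a b, is_succ a b -> Y a `\` Y b `<=` Max (Y a) }.

Definition compactly_layered (R : comNzRingType) : Prop :=
  exists (d : Order.disp_t) (W : orderType d) (Y : W -> set (Spec R)),
    layering Y.

Section FractionalIdeals.
Context {D : idomainType}.
Local Notation K := {fraction D}.
Local Notation "x %:F" := (FracField.tofrac x).

Definition base_ring : set K := range (@FracField.tofrac D).

Definition submodule (J : set K) : Prop :=
  [/\ J 0, forall x y, J x -> J y -> J (x + y)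
    & forall (a : D) x, J x -> J (a%:F * x)].

Definition fractional (J : set K) : Prop :=
  submodule J /\
  exists2 d : D, d != 0 & forall x, J x -> base_ring (d%:F * x).

Definition invertible (J : set K) : Prop :=
  fractional J /\
  exists2 J' : set K, fractional J' & prod_ideal J J' = base_ring.

(* (D : J) *)
Definition inv_ideal (J : set K) : set K :=
  [set x | forall y, J y -> base_ring (x * y)].

Lemma prod_ideal_sub (A B T : set K) :
    T 0 -> (forall x y, T x -> T y -> T (x + y)) ->
    (forall a b, A a -> B b -> T (a * b)) ->
  prod_ideal A B `<=` T.
Proof.
move=> T0 TD TM _ [s sAB ->]; rewrite big_seq.
by elim/big_ind: _ => // p /sAB[Ap Bp]; exact: TM.
Qed.

Lemma prod_ideal_mem (A B : set K) a b :
  A a -> B b -> prod_ideal A B (a * b).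
Proof.
move=> Aa Bb; exists [:: (a, b)]; last by rewrite big_seq1.
by move=> p; rewrite inE => /eqP->.
Qed.

Lemma prod_ideal0 (A B : set K) : prod_ideal A B 0.
Proof. by exists [::]; rewrite ?big_nil. Qed.

Lemma prod_idealD (A B : set K) x y :
  prod_ideal A B x -> prod_ideal A B y -> prod_ideal A B (x + y).
Proof.
move=> [s sAB ->] [t tAB ->]; exists (s ++ t); last by rewrite big_cat.
by move=> p; rewrite mem_cat => /orP[/sAB|/tAB].
Qed.

Lemma prod_ideal_submodule (A B : set K) :
  submodule A -> submodule (prod_ideal A B).
Proof.
move=> [_ _ AZ]; split; [exact: prod_ideal0|exact: prod_idealD|].
move=> a x; apply: (@prod_ideal_sub _ _ (fun x => prod_ideal A B (a%:F * x))).
- by rewrite mulr0; exact: prod_ideal0.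
- by move=> {}x y ABx ABy; rewrite mulrDr; exact: prod_idealD.
- by move=> u v Au Bv; rewrite mulrA; apply: prod_ideal_mem => //; exact: AZ.
Qed.

Lemma prod_idealC : commutative (@prod_ideal K).
Proof.
suff sub A B : @prod_ideal K A B `<=` prod_ideal B A.
  by move=> A B; apply/seteqP; split; exact: sub.
apply: prod_ideal_sub; [exact: prod_ideal0|exact: prod_idealD|].
by move=> a b Aa Bb; rewrite mulrC; exact: prod_ideal_mem.
Qed.

Lemma prod_idealA : associative (@prod_ideal K).
Proof.
suff sub A B C :
    @prod_ideal K (prod_ideal A B) C `<=` prod_ideal A (prod_ideal B C).
  move=> A B C; apply/seteqP; split; last exact: sub.
  rewrite prod_idealC (prod_idealC B) (prod_idealC _ C) (prod_idealC A).
  exact: sub.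
apply: prod_ideal_sub; [exact: prod_ideal0|exact: prod_idealD|].
move=> x c ABx Cc; move: x ABx.
apply: (@prod_ideal_sub _ _ (fun x => prod_ideal A (prod_ideal B C) (x * c))).
- by rewrite mul0r; exact: prod_ideal0.
- by move=> x y Tx Ty; rewrite mulrDl; exact: prod_idealD.
- move=> a b Aa Bb; rewrite -mulrA; apply: prod_ideal_mem => //.
  exact: prod_ideal_mem.
Qed.

Lemma base_ring_submodule : submodule base_ring.
Proof.
split; first by exists 0; rewrite ?rmorph0.
- by move=> _ _ [a _ <-] [b _ <-]; exists (a + b); rewrite ?rmorphD.
- by move=> a _ [b _ <-]; exists (a * b); rewrite ?rmorphM.
Qed.

Lemma base_ringM x y : base_ring x -> base_ring y -> base_ring (x * y).
Proof. by move=> [a _ <-]; have [_ _] := base_ring_submodule; apply. Qed.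

Lemma base_ring1 : base_ring 1.
Proof. by exists 1; rewrite ?rmorph1. Qed.

Lemma prod_1ideal (J : set K) : submodule J -> prod_ideal base_ring J = J.
Proof.
move=> [J0 JD JZ]; apply/seteqP; split => [|x Jx].
  by apply: prod_ideal_sub => // _ y [a _ <-]; exact: JZ.
by rewrite -[x]mul1r; apply: prod_ideal_mem => //; exact: base_ring1.
Qed.

Lemma fractional_base_ring : fractional base_ring.
Proof.
split; first exact: base_ring_submodule.
by exists 1; rewrite ?oner_neq0 // rmorph1 => x; rewrite mul1r.
Qed.

Lemma fractionalM (I J : set K) :
  fractional I -> fractional J -> fractional (prod_ideal I J).
Proof.
move=> [sI [d d0 dI]] [sJ [e e0 eJ]].
split; first exact: prod_ideal_submodule.
exists (d * e); first by rewrite mulf_neq0.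
rewrite rmorphM.
apply: (@prod_ideal_sub _ _ (fun x => base_ring (d%:F * e%:F * x))).
- by rewrite mulr0; case: base_ring_submodule.
- by move=> x y; rewrite mulrDr; case: base_ring_submodule => _ + _; apply.
- by move=> a b Ia Jb; rewrite mulrACA; apply: base_ringM; [exact: dI|exact: eJ].
Qed.

Lemma invertible_base_ring : invertible base_ring.
Proof.
split; first exact: fractional_base_ring.
exists base_ring; first exact: fractional_base_ring.
exact/prod_1ideal/base_ring_submodule.
Qed.

Lemma invertibleM (I J : set K) :
  invertible I -> invertible J -> invertible (prod_ideal I J).
Proof.
move=> [fI [I' fI' II']] [fJ [J' fJ' JJ']]; split; first exact: fractionalM.
exists (prod_ideal I' J'); first exact: fractionalM.
rewrite prod_idealA -(prod_idealA I) (prod_idealC J) (prod_idealA I) II'.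
by rewrite -prod_idealA JJ' prod_1ideal//; exact: base_ring_submodule.
Qed.

Lemma inv_idealE (J J' : set K) :
  submodule J' -> prod_ideal J J' = base_ring -> inv_ideal J = J'.
Proof.
move=> [J'0 J'D J'Z] JJ'; apply/seteqP; split => x.
  move=> xJ; have := base_ring1; rewrite -JJ' -[X in _ -> J' X]mulr1.
  move: (1 : K).
  apply: (@prod_ideal_sub _ _ (fun y => J' (x * y))).
  - by rewrite mulr0.
  - by move=> y z ? ?; rewrite mulrDr; exact: J'D.
  - by move=> a b /xJ[c _ xa] J'b; rewrite mulrA -xa; exact: J'Z.
by move=> J'x y Jy; rewrite mulrC -JJ'; exact: prod_ideal_mem.
Qed.

Lemma invertibleV (J : set K) :
  invertible J -> invertible (inv_ideal J).
Proof.
move=> [fJ [J' fJ' JJ']]; rewrite (inv_idealE fJ'.1 JJ').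
by split=> //; exists J => //; rewrite prod_idealC.
Qed.

Lemma prod_inv_ideal (J : set K) :
  invertible J -> prod_ideal (inv_ideal J) J = base_ring.
Proof.
by move=> [_ [J' fJ' JJ']]; rewrite (inv_idealE fJ'.1 JJ') prod_idealC.
Qed.

End FractionalIdeals.

Record Inv (D : idomainType) : Type := MkInv {
  inv_set :> set {fraction D};
  inv_setP : invertible inv_set }.

HB.instance Definition _ (D : idomainType) := gen_eqMixin (Inv D).
HB.instance Definition _ (D : idomainType) := gen_choiceMixin (Inv D).

Section InvGroup.
Context {D : idomainType}.
Implicit Types I J : Inv D.

Lemma inv_set_inj : injective (@inv_set D).
Proof. by move=> [I pI] [J pJ] /= eIJ; subst J; congr MkInv; exact: Prop_irrelevance. Qed.

Definition Inv_one : Inv D := MkInv invertible_base_ring.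
Definition Inv_mul I J : Inv D := MkInv (invertibleM (inv_setP I) (inv_setP J)).
Definition Inv_inv J : Inv D := MkInv (invertibleV (inv_setP J)).

Lemma Inv_mulC : commutative Inv_mul.
Proof. by move=> I J; apply: inv_set_inj; exact: prod_idealC. Qed.

Lemma Inv_mulA : associative Inv_mul.
Proof. by move=> I J L; apply: inv_set_inj; exact: prod_idealA. Qed.

Lemma Inv_mul1 : left_id Inv_one Inv_mul.
Proof.
by move=> J; apply: inv_set_inj; apply: prod_1ideal; exact: (inv_setP J).1.1.
Qed.

Lemma Inv_mulr1 : right_id Inv_one Inv_mul.
Proof. by move=> J; rewrite Inv_mulC Inv_mul1. Qed.

Lemma Inv_mulV : left_inverse Inv_one Inv_inv Inv_mul.
Proof. by move=> J; apply: inv_set_inj; exact/prod_inv_ideal/inv_setP. Qed.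

Lemma Inv_mulrV : right_inverse Inv_one Inv_inv Inv_mul.
Proof. by move=> J; rewrite Inv_mulC Inv_mulV. Qed.

End InvGroup.

HB.instance Definition _ (D : idomainType) := isGroup.Build (Inv D)
  (@Inv_mulA D) (@Inv_mul1 D) (@Inv_mulr1 D) (@Inv_mulV D) (@Inv_mulrV D).

Definition prufer (D : idomainType) : Prop :=
  forall I : set D, fin_gen_ideal I -> I <> [set 0] ->
    invertible (@FracField.tofrac D @` I).

Definition strongly_discrete (D : idomainType) : Prop :=
  forall P : Spec D, ideal_of P <> [set 0] ->
    ideal_of P <> prod_ideal (ideal_of P) (ideal_of P).

Definition CSD_domain (D : idomainType) : Prop :=
  [/\ prufer D, strongly_discrete D & compactly_layered D].

(* G, written multiplicatively, is isomorphic to a direct sum of copies of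
   the additive group of the integers; this forces G to be commutative. *)
Definition free_abelian (G : groupType) : Prop :=
  exists (B : choiceType) (f : {freeg B} -> G),
    bijective f /\ {morph f : x y / x + y >-> (x * y)%g}.

(* Main.v *)
From mathcomp Require Import all_boot all_order all_algebra.
From mathcomp Require Import boolp classical_sets functions filter.
From mathcomp Require Import topology_structure compact.
From mathcomp Require Import finmap zify.
From mathcomp Require wochoice.
From mathcomp.multinomials Require Import freeg.
From HB Require Import structures.
Require Import Defs.

(** An abelian group is free as soon as it has an increasing, continuous,
    well-ordered filtration by subgroups whose successive quotients embed in
    the integers: for every index that occurs choose an element whose leading
    coefficient generates the corresponding subgroup of the integers
    ([Zfiltration_free]).  Having such a filtration is far more flexible than
    being free: it passes to subgroups and along injective additive
    correspondences ([Zfiltered_pullback]), and a group filtered in a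
    well-ordered way by pieces that have such a filtration has one itself
    ([Zfiltered_sum]).  The theorem follows from three uses of this principle,
    nested in one another.

    The outer filtration comes from the layers.  Let T_P be the group of the
    invertible ideals J with J D_P = D_P.  The ideals that lie in T_P for all P
    in Y_a form an increasing family of subgroups of Inv(D).  It starts from
    the trivial group, since an ideal that is locally trivial everywhere is
    trivial; it ends with Inv(D), since some Y_c is empty; and it is
    continuous, since Spec(D) is compact for a topology in which the Y_a are
    closed and the set of P with J in T_P is open.  If J lies in T_Q for all Q
    in Y_b, where b is the successor of a, and P is in Y_a but not in Y_b, then
    every prime strictly below P is in Y_b.  This makes J archimedean at P, and
    as P is not idempotent, J D_P is an integral power of P D_P
    ([layer_value]).  The quotient at a is thus a group of integer-valued
    functions on the compact space Y_a; they have locally constant signs, and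
    at each point they take all integers as values, or only 0.

    These functions may be unbounded; they already are for some almost
    Dedekind domains.  The middle filtration takes care of this.  For a closed
    set C, let C' be the set of the points of C that have no clopen
    neighbourhood on which all functions of the group are bounded on C.  A
    function that vanishes on C' is bounded on C, by compactness
    ([bounded_off_deriv]).  A nested sequence of compact sets on which a
    function decreases again and again shows that C' = C only if all functions
    vanish on C ([deriv_fixed]).  Hence the iterated derivatives, intersected
    at limits, reduce everything to groups of bounded functions
    ([Zfiltered_sign_continuous]).

    The inner filtration is that of Nöbeling's theorem for bounded functions
    ([Zfiltered_bounded]).  Sets are enumerated by a well-ordering, functions
    are filtered by the sets on which they depend, and the function
    f = f1 on E, f0 off E, is sent to f1 - f0, which depends on earlier sets
    only.  Working modulo an ideal of negligible sets lets this step be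
    iterated. *)

Set Implicit Arguments.
Unset Strict Implicit.
Unset Printing Implicit Defensive.

Import Order.TTheory GRing.Theory Num.Theory.
Local Open Scope ring_scope.
Local Open Scope classical_set_scope.

(** * Well-orderings *)

Record well_ordering (W : Type) (lt : W -> W -> Prop) : Prop := WellOrdering {
  wo_wf : well_founded lt;
  wo_tri : forall a b, [\/ lt a b, a = b | lt b a] }.

Section WellOrderings.
Context {W : Type} {lt : W -> W -> Prop} (wo : well_ordering lt).

Lemma wo_asym a b : lt a b -> ~ lt b a.
Proof. by elim: (wo_wf wo a) b => {}a _ IH b ab ba; exact: (IH b ba a). Qed.

Lemma wo_trans b a c : lt a b -> lt b c -> lt a c.
Proof.
move=> ab bc; have [//|ac|ca] := wo_tri wo a c.
  by case: (wo_asym ab); rewrite ac.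
exfalso; elim: (wo_wf wo a) b c ab bc ca => {}a _ IH b c ab bc ca.
exact: (IH c ca a b ca ab bc).
Qed.

Lemma wo_min (P : W -> Prop) :
  (exists w, P w) -> exists2 w, P w & forall v, lt v w -> ~ P v.
Proof.
move=> [w Pw]; apply: contrapT => nomin.
elim: (wo_wf wo w) Pw => {}w _ IH Pw.
by apply: nomin; exists w => // v vw Pv; exact: (IH v).
Qed.

Lemma wo_seq_max (T : eqType) (h : T -> W) (s : seq T) : s != [::] ->
  exists2 m, m \in s & forall w, w \in s -> h w = h m \/ lt (h w) (h m).
Proof.
elim: s => // a [_ _|b s /(_ isT)[m ms mmax] _].
  by exists a => [|w]; rewrite ?inE // => /eqP->; left.
have [am|am|ma] := wo_tri wo (h a) (h m).
- exists m => [|w]; rewrite inE ?ms ?orbT // => /orP[/eqP->|/mmax //]; by right.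
- exists m => [|w]; rewrite inE ?ms ?orbT // => /orP[/eqP->|/mmax //]; by left.
- exists a => [|w]; rewrite inE ?eqxx // => /orP[/eqP->|/mmax]; first by left.
  by case=> [->|wm]; right => //; exact: wo_trans ma.
Qed.

End WellOrderings.

Lemma strict_well_ordering (T : eqType) (R : rel T) :
  wochoice.well_order R -> well_ordering (fun a b => a != b /\ R a b).
Proof.
move=> wo.
have anti : antisymmetric R.
  have := @wochoice.wo_chain_antisymmetric T R predT.
  by move/(_ (fun A _ => wo A)) => anti a b; exact: (anti a b isT isT).
split=> [a|a b].
  pose bad : pred T := [pred x | `[< ~ Acc (fun a b => a != b /\ R a b) x >]].
  apply: contrapT => nacc.
  have [|m [[mA mmin] _]] := wo bad; first by exists a; apply/asboolP.
  move/asboolP: mA; apply; constructor=> b [bm Rbm].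
  apply: contrapT => nb; have /mmin Rmb : b \in bad by exact/asboolP.
  by move: bm; rewrite (anti b m) ?Rbm ?eqxx.
have [->|ab] := eqVneq a b; first exact: Or32.
have [|m [[+ mmin] _]] := wo (pred2 a b); first by exists a; rewrite inE eqxx.
have Rma : R m a by apply: mmin; rewrite inE eqxx.
have Rmb : R m b by apply: mmin; rewrite inE eqxx orbT.
case/orP=> /eqP em; rewrite em in Rma Rmb; first exact: Or31.
exact: Or33.
Qed.

Lemma exists_well_ordering (T : Type) :
  exists lt : T -> T -> Prop, well_ordering lt.
Proof.
have [R /strict_well_ordering wo] := wochoice.well_ordering_principle {classic T}.
by eexists; exact: wo.
Qed.

(** * Filtrations with infinite cyclic quotients *)

Definition sub_closed (G : zmodType) (H : set G) :=
  forall x y, H x -> H y -> H (x - y).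

(** [lead w x n] reads: x lies in the w-th subgroup of the filtration and n is
    its image in the w-th quotient, embedded in the integers.  Using a relation
    rather than a subgroup with a morphism on it makes pullbacks and sums mere
    compositions of relations.  The pair (H, N) stands for the quotient of H
    by N: all pieces of the filtration contain N, and an element of H outside N
    has a nonzero leading coefficient at some index.  The pieces may exceed H,
    so that a filtration for H is one for every subset of H. *)
Record Zfiltration (G : zmodType) (H N : set G) : Type := MkZfiltration {
  Zidx : Type;
  Zlt : Zidx -> Zidx -> Prop;
  lead : Zidx -> G -> int -> Prop;
  Zlt_wo : well_ordering Zlt;
  leadB : forall w x y m n, lead w x m -> lead w y n -> lead w (x - y) (m - n);
  lead_null : forall w x n, N x -> lead w x n <-> n = 0;
  lead_lt : forall v w x n, Zlt v w -> lead v x n -> lead w x 0;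
  lead_neq0 : forall x, H x -> ~ N x ->
    exists w, exists2 n, lead w x n & n <> 0 }.

Definition Zfiltered (G : zmodType) (H N : set G) : Prop :=
  exists _ : Zfiltration H N, True.

Lemma Zfiltered_trivial (G : zmodType) (H N : set G) :
  H `<=` N -> Zfiltered H N.
Proof.
move=> HN; unshelve eexists.
  apply: (@MkZfiltration _ _ _ False (fun _ _ => False) (fun _ _ _ => False)).
  all: by move=> // x /HN.
Qed.

(** The hypotheses on [phi] say that it induces an injective additive map from
    the subquotient (H, N) to the subquotient (H', N').  A correspondence is
    needed because the maps used below are only well defined modulo N'. *)
Lemma Zfiltered_pullback (G G' : zmodType) (H N : set G) (H' N' : set G')
    (phi : G -> G' -> Prop) :
  (forall x y x' y', phi x x' -> phi y y' -> phi (x - y) (x' - y')) ->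
  (forall x, N x -> exists2 x', phi x x' & N' x') ->
  (forall x x', N x -> phi x x' -> N' x') ->
  (forall x, H x -> ~ N x -> exists x', [/\ phi x x', H' x' & ~ N' x']) ->
  Zfiltered H' N' -> Zfiltered H N.
Proof.
move=> phiB Nphi phiN phiH [z _]; unshelve eexists; last by [].
apply: (@MkZfiltration _ _ _ (Zidx z) (@Zlt _ _ _ z)
  (fun w x n => exists2 x', phi x x' & lead w x' n)).
- exact: Zlt_wo.
- move=> w x y m n [x' xx' x'm] [y' yy' y'n].
  by exists (x' - y'); [exact: phiB|exact: leadB].
- move=> w x n Nx; split=> [[x' xx' x'n]|->].
    by apply/(lead_null w (x := x')) => //; exact: phiN xx'.
  by have [x' xx' N'x'] := Nphi x Nx; exists x' => //; exact/lead_null.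
- by move=> v w x n vw [x' xx' x'n]; exists x' => //; exact: lead_lt vw x'n.
- move=> x Hx Nx; have [x' [xx' H'x' N'x']] := phiH x Hx Nx.
  by have [w [n x'n n0]] := lead_neq0 z H'x' N'x'; exists w, n => //; exists x'.
Qed.

Section LexicographicSum.
Context {A : Type} {ltA : A -> A -> Prop} (woA : well_ordering ltA).
Context {W : A -> Type} {lt : forall a, W a -> W a -> Prop}.
Hypothesis wo : forall a, well_ordering (@lt a).

Definition lex_lt (p q : {a & W a}) : Prop :=
  ltA (projT1 p) (projT1 q) \/
  exists e : projT1 p = projT1 q, lt (ecast a (W a) e (projT2 p)) (projT2 q).

(** The index set of a filtration refined piece by piece. *)
Lemma lex_well_ordering : well_ordering lex_lt.
Proof.
split=> [[a w]|[a v] [b w]].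
  elim: (wo_wf woA a) w => {}a _ IHa w.
  elim: (wo_wf (wo a) w) => {}w _ IHw; constructor=> -[b v] [/=|[/= e]].
    by move=> ba; exact: IHa.
  by case: a / e {IHa} w IHw => w IHw /= vw; exact: IHw.
have [ab|ab|ba] := wo_tri woA a b; [by apply: Or31; left| |by apply: Or33; left].
subst b; have [vw|->|wv] := wo_tri (wo a) v w; last 1 first.
- by apply: Or33; right; exists erefl.
- by apply: Or31; right; exists erefl.
- exact: Or32.
Qed.

End LexicographicSum.

(** Each element of H outside N first appears in some HA a outside NA a; this
    index comes first and the leading index of the element in the filtration
    of HA a modulo NA a comes second. *)
Lemma Zfiltered_sum (G : zmodType) (H N : set G)
    (A : Type) (lt : A -> A -> Prop) (HA NA : A -> set G) :
  well_ordering lt ->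
  (forall a, sub_closed (HA a)) ->
  (forall a, N `<=` HA a `&` NA a) ->
  (forall a b, lt a b -> HA a `<=` HA b `&` NA b) ->
  (forall x, H x -> ~ N x -> exists a, HA a x /\ ~ NA a x) ->
  (forall a, Zfiltered (HA a) (NA a)) -> Zfiltered H N.
Proof.
move=> woA HAB NHN HANA HHA zA; unshelve eexists; last by [].
have z a : Zfiltration (HA a) (NA a) by exact: projT1 (cid (zA a)).
apply: (@MkZfiltration _ _ _ {a & Zidx (z a)}
  (@lex_lt A lt _ (fun a => @Zlt _ _ _ (z a)))
  (fun w x n => HA (projT1 w) x /\ lead (projT2 w) x n)).
- exact: (@lex_well_ordering A lt woA _ _ (fun a => Zlt_wo (z a))).
- move=> [a w] x y m n /= [Hx xm] [Hy yn]; split; first exact: HAB.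
  exact: leadB.
- move=> [a w] x n /= Nx; have [HAx NAx] := NHN a x Nx.
  split=> [[_] /lead_null|->]; first exact.
  by split=> //; exact/lead_null.
- move=> [a v] [b w] x n [/= ab|[/= e vw]] [HAx leadx].
    have [HBx NBx] := HANA a b ab x HAx; split=> //.
    exact/lead_null.
  case: b / e w vw => w /= vw.
  by split=> //; exact: lead_lt vw leadx.
- move=> x Hx Nx; have [a [HAx NAx]] := HHA x Hx Nx.
  by have [w [n wn n0]] := lead_neq0 (z a) HAx NAx; exists (existT _ a w), n.
Qed.

Section FreeBasis.
Context {G : zmodType} (z : @Zfiltration G setT [set 0]).
Implicit Types (w : Zidx z).

Lemma lead0 w : lead w 0 0.
Proof. exact/lead_null. Qed.

Lemma lead_fun w x m n : lead w x m -> lead w x n -> m = n.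
Proof.
move=> xm xn; have := leadB xm xn; rewrite subrr => /lead_null.
by move/(_ erefl) => /eqP; rewrite subr_eq0 => /eqP.
Qed.

Lemma leadN w x m : lead w x m -> lead w (- x) (- m).
Proof. by move=> /(leadB (lead0 w)); rewrite !sub0r. Qed.

Lemma leadD w x y m n : lead w x m -> lead w y n -> lead w (x + y) (m + n).
Proof. by move=> xm /leadN /(leadB xm); rewrite !opprK. Qed.

Lemma leadMz w x m (k : int) : lead w x m -> lead w (x *~ k) (k * m).
Proof.
have leadMn y j i : lead w y j -> lead w (y *+ i) (i%:Z * j).
  move=> yj; elim: i => [|i IH]; first by rewrite mulr0n mul0r; exact: lead0.
  by rewrite mulrS intS mulrDl mul1r; exact: leadD.
move=> xm; case: k => k; first exact: leadMn.
by rewrite NegzE mulrNz mulNr; exact/leadN/leadMn.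
Qed.

Definition is_lead w := exists x, exists2 n, lead w x n & n <> 0.

(** The leading coefficients at w form a nonzero subgroup of the integers,
    generated by its least positive element. *)
Lemma lead_generator w : is_lead w ->
  exists b, exists2 d, lead w b d & d <> 0 /\ forall x n, lead w x n -> (d %| n)%Z.
Proof.
move=> [x [n xn n0]].
have exd : exists d : nat, `[< exists b, lead w b d.+1%:Z >].
  exists `|n|.-1; apply/asboolP; rewrite prednK ?absz_gt0; last exact/eqP.
  have [n_ge0|n_lt0] := leP 0 n; first by exists x; rewrite gez0_abs.
  by exists (- x); rewrite ltz0_abs //; exact: leadN.
case: (ex_minnP exd) => d /asboolP[b bd] dmin; exists b, d.+1%:Z => //; split=> //.
move=> y m ym; apply/dvdz_mod0P/eqP/contraT => r0.
have r_ge0 : 0 <= (m %% d.+1)%Z by exact: modz_ge0.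
have r_lt : (m %% d.+1)%Z < d.+1 by exact: ltz_pmod.
have : lead w (y - b *~ (m %/ d.+1)%Z) (m %% d.+1)%Z.
  by rewrite /modz; exact/(leadB ym)/leadMz.
case: (m %% d.+1)%Z r_ge0 r_lt r0 => // -[//|r] _ rd _ lr.
have /dmin : `[< exists b, lead w b r.+1 >] by apply/asboolP; eexists; exact: lr.
by move: rd; rewrite ltz_nat ltnS ltnNge => /negP.
Qed.

(** Elements [b w] whose leading coefficients generate form a basis: they
    generate by well-founded induction on the leading index, as subtracting a
    multiple of [b w] lowers the index, and they are independent because the
    largest index in a combination is its leading index. *)
Lemma Zfiltration_free : exists (B : choiceType) (f : {freeg B} -> G),
  bijective f /\ {morph f : x y / x + y >-> x + y}.
Proof.
pose B : choiceType := {classic {w : Zidx z | is_lead w}}.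
have /choice[g gP] (w : B) : exists bd : G * int, [/\ lead (sval w) bd.1 bd.2,
    bd.2 <> 0 & forall x n, lead (sval w) x n -> (bd.2 %| n)%Z].
  by have [b [d bd [d0 dvd]]] := lead_generator (proj2_sig w); exists (b, d).
pose b (w : B) := (g w).1; pose d (w : B) := (g w).2.
pose f : {freeg B} -> G := fglift (fun w : B => b w : zmodule G).
have fB : {morph f : x y / x - y} 
  by move=> x y; exact: (@lift_is_additive int B (zmodule G)).
have f0 : f 0 = 0 by rewrite -[X in f X](subrr 0) fB subrr.
have fN : {morph f : x / - x} by move=> x; rewrite -[- x]sub0r fB f0 sub0r.
have fD : {morph f : x y / x + y} by move=> x y; rewrite -{1}[y]opprK fB fN opprK.
have fU k (w : B) : f << k *g w >> = b w *~ k by rewrite /f liftU.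
exists B, f; split=> //.
(* The coefficient of the largest index of D survives in f D. *)
have finj D : f D = 0 -> D = 0.
  move=> fD0; apply/eqP; rewrite -dom_eq0; apply: contraT => dom0.
  have [m mD mmax] := wo_seq_max (Zlt_wo z) (fun w : B => sval w) dom0.
  have [bm dm0 _] := gP m.
  have cm0 : coeff m D != 0 by rewrite -mem_dom.
  suff /lead_null : lead (sval m) (f D) (coeff m D * d m).
    by move=> /(_ fD0) /eqP; rewrite mulf_eq0 (negPf cm0) => /eqP.
  rewrite -[X in f X]freeg_sumE (big_morph f fD f0) (bigD1_seq m) ?uniq_dom //=.
  rewrite fU -[_ * d m]addr0; apply: leadD; first exact: (leadMz (coeff m D) bm).
  rewrite big_seq_cond.
  elim/big_ind : _ => [|x y lx ly|w /andP[wD wm]]; first exact: lead0.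
    by rewrite -(addr0 (0 : int)); exact: leadD.
  rewrite fU; have [bw _ _] := gP w; have [ewm|wltm] := mmax w wD.
    case/eqP: wm; case: (w) (m) ewm => [w' pw] [m' pm] /= e; subst w'.
    by congr exist; exact: Prop_irrelevance.
  rewrite -(mulr0 (coeff w D)); exact/leadMz/(lead_lt wltm bw).
have fsurj x : exists D, f D = x.
  have surj w y n : lead w y n -> exists D, f D = y.
    elim: (wo_wf (Zlt_wo z) w) y n => {}w _ IH.
    have IH0 y : lead w y 0 -> exists D, f D = y.
      move=> y0; have [->|yn0] := pselect (y = 0); first by exists 0.
      have [v [n vy n0]] := lead_neq0 z (x := y) I yn0.
      have [vw|vw|wv] := wo_tri (Zlt_wo z) v w; first exact: IH vw _ _ vy.
        by case: n0; subst v; exact: lead_fun vy y0.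
      by case: n0; apply: lead_fun vy _; exact: lead_lt wv y0.
    move=> y n wy; have [n0|n0] := pselect (n = 0); first by apply: IH0; rewrite -n0.
    have wB : is_lead w by exists y, n.
    have [bw _ /(_ _ _ wy) /dvdzP[q nq]] := gP (exist _ w wB).
    have [|D fD1] := IH0 (y - b (exist _ w wB) *~ q).
      by rewrite -(subrr n) {2}nq; apply: leadB => //; exact: leadMz.
    by exists (D + << q *g (exist _ w wB : B) >>); rewrite fD fD1 fU subrK.
  have [->|x0] := pselect (x = 0); first by exists 0.
  by have [w [n wx _]] := lead_neq0 z (x := x) I x0; exact: surj wx.
have /choice[h hP] := fsurj.
exists h => [D|x]; last exact: hP.
by apply/eqP; rewrite -subr_eq0; apply/eqP/finj; rewrite fB hP subrr.
Qed.

End FreeBasis.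

(** * Nöbeling's theorem on bounded functions *)
Record null_ideal (X : Type) (N : set (set X)) : Prop := NullIdeal {
  null0 : N set0;
  nullS : forall A B, A `<=` B -> N B -> N A;
  nullU : forall A B, N A -> N B -> N (A `|` B) }.

Definition null_fun (X : Type) (N : set (set X)) : set (X -> int) :=
  [set F | N [set x | F x <> 0]].

Section NullFunctions.
Context {X : Type} {N : set (set X)} (idN : null_ideal N).

Lemma null_fun0 : null_fun N 0.
Proof. by apply: (nullS idN) (null0 idN) => x /=. Qed.

Lemma null_funB F F' : null_fun N F -> null_fun N F' -> null_fun N (F - F').
Proof.
move=> nF nF'; apply: (nullS idN) (nullU idN nF nF') => x /= FF'.
have [Fx|] := pselect (F x = 0); last by left.
by right=> F'x; apply: FF'; rewrite -[LHS]/(F x - F' x) Fx F'x.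
Qed.

End NullFunctions.

Section FiniteSupport.
Context {I : eqType}.
Implicit Types (P : set I) (U V : Type).
Local Notation X := (I -> bool).

Definition fin_supp P U : set (X -> U) :=
  [set F | exists2 s : seq I, (forall i, i \in s -> P i) &
    forall x y : X, (forall i, i \in s -> x i = y i) -> F x = F y].

Lemma fin_suppS P P' U : P `<=` P' -> @fin_supp P U `<=` @fin_supp P' U.
Proof. by move=> PP' F [s sP Fs]; exists s => // i /sP/PP'. Qed.

Lemma fin_supp_cst P U (u : U) : fin_supp P (fun=> u).
Proof. by exists [::]. Qed.

Lemma fin_supp2 P U V V' (op : U -> V -> V') F G :
  fin_supp P F -> fin_supp P G -> fin_supp P (fun x => op (F x) (G x)).
Proof.
move=> [s sP Fs] [t tP Gt]; exists (s ++ t) => [i|x y xy].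
  by rewrite mem_cat => /orP[/sP|/tP].
by congr op; [apply: Fs|apply: Gt] => i it; apply: xy; rewrite mem_cat it ?orbT.
Qed.

Lemma fin_suppB P (F G : X -> int) :
  fin_supp P F -> fin_supp P G -> fin_supp P (F - G).
Proof. exact: (fin_supp2 (fun m n => m - n)). Qed.

Definition update (k : I) (b : bool) (x : X) : X :=
  fun i => if i == k then b else x i.

(** Freezing the coordinate k removes k from the support; this is why functions
    are taken on the whole cube rather than on a subset of it, the subset being
    recovered by declaring its complement null. *)
Lemma fin_supp_update P k b U (F : X -> U) :
  fin_supp P F -> fin_supp (P `&` [set~ k]) (F \o update k b).
Proof.
move=> [s sP Fs]; exists [seq i <- s | i != k] => [i|x y xy /=].
  by rewrite mem_filter => /andP[/eqP ik /sP].
apply: Fs => i si; rewrite /update; case: eqP => // /eqP ik.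
by apply: xy; rewrite mem_filter ik.
Qed.

Context (lt : I -> I -> Prop) (wo : well_ordering lt).

Definition below (k : I) : set I := [set i | lt i k].
Definition upto (k : I) : set I := [set i | lt i k \/ i = k].

(** A finite support has a largest element, so the filtration of functions by
    their support is automatically continuous at limits. *)
Lemma fin_supp_upto P U (F : X -> U) : fin_supp P F ->
  (exists u, F = fun=> u) \/ exists2 k, P k & fin_supp (P `&` upto k) F.
Proof.
move=> [[|a s] sP Fs].
  by left; exists (F (fun=> false)); apply/funext => x; exact: Fs.
have [m ms mmax] := @wo_seq_max _ _ wo _ id (a :: s) isT.
right; exists m; first exact: sP.
by exists (a :: s) => // i si; split; [exact: sP|have [->|] := mmax i si; [right|left]].
Qed.

End FiniteSupport.

Section Nobeling.
Context {I : eqType} {lt : I -> I -> Prop} (wo : well_ordering lt).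
Local Notation X := (I -> bool).
Implicit Types (P : set I) (N : set (set X)) (F a b : X -> int).

Definition splice (k : I) (U : Type) (a b : X -> U) : X -> U :=
  fun x => if x k then a x else b x.

(** Think of N as the ideal of the sets that miss a closed subset S of the cube.
    Among the sets that depend on finitely many coordinates below k, those in
    [sep_null N k] are then the sets that miss every point whose coordinates
    below k extend to points of S with both values of the coordinate k: at such
    points the two halves of a function on S can be compared. *)
Definition sep_null N (k : I) : set (set X) :=
  [set A : set X | exists B C : set X,
    [/\ fin_supp (below lt k) B, fin_supp (below lt k) C,
    A `<=` B `|` C, N (B `&` [set x : X | x k]) & N (C `&` [set x : X | ~~ x k])]].

Lemma sep_null_ideal N k : null_ideal N -> null_ideal (sep_null N k).
Proof.
move=> idN; split.
- exists set0, set0; rewrite !set0I; split=> //; try exact: null0.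
  + exact: (fin_supp_cst _ False).
  + exact: (fin_supp_cst _ False).
- move=> A A' AA' [B [C [fB fC A'BC nB nC]]]; exists B, C; split=> //.
  exact: subset_trans A'BC.
- move=> A A' [B [C [fB fC ABC nB nC]]] [B' [C' [fB' fC' ABC' nB' nC']]].
  exists (B `|` B'), (C `|` C'); rewrite !setIUl; split.
  + exact: (fin_supp2 or).
  + exact: (fin_supp2 or).
  + by rewrite setUACA; exact: setUSS.
  + exact: nullU.
  + exact: nullU.
Qed.

Definition mod_null N (L : set (X -> int)) : set (X -> int) :=
  [set F | exists2 F', L F' & null_fun N (F - F')].

Lemma mod_nullB N P : null_ideal N -> sub_closed (mod_null N (@fin_supp I P int)).
Proof.
move=> idN F G [F' LF' nF] [G' LG' nG]; exists (F' - G'); first exact: fin_suppB.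
have -> : F - G - (F' - G') = F - F' - (G - G').
  by apply/funext => x; rewrite !fctE; lia.
exact: null_funB.
Qed.

(** A function supported up to k is a splice of functions a and b supported
    below k, and a - b is null exactly when the function agrees, modulo N, with
    one supported below k.  For the latter, if a and b differ only on the union
    of B and C, with B null where x k holds and C null elsewhere, then the
    function equal to a on C and to b off C represents the splice. *)
Lemma Zfiltered_step N k :
  null_ideal N ->
  (forall N', null_ideal N' ->
     Zfiltered (@fin_supp I (below lt k) int) (null_fun N')) ->
  Zfiltered (mod_null N (@fin_supp I (upto lt k) int))
            (mod_null N (@fin_supp I (below lt k) int)).
Proof.
move=> idN /(_ _ (sep_null_ideal k idN)).
apply: (@Zfiltered_pullback _ _ _ _ _ _ (fun F h => exists a b : X -> int,
  [/\ fin_supp (below lt k) a, fin_supp (below lt k) b, h = a - b &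
      null_fun N (F - splice k a b)])).
- move=> F F' h h' [a [b [fa fb -> nF]]] [a' [b' [fa' fb' -> nF']]].
  exists (a - a'), (b - b'); split; [exact: fin_suppB|exact: fin_suppB| |].
    by apply/funext => x; rewrite /= !fctE; lia.
  suff -> : F - F' - splice k (a - a') (b - b') =
      F - splice k a b - (F' - splice k a' b') by exact: null_funB.
  by apply/funext => x; rewrite /splice /= !fctE; case: ifP => _; lia.
- move=> F [F' fF' nF]; exists 0; last exact/null_fun0/sep_null_ideal.
  exists F', F'; split=> //; first by rewrite subrr.
  suff -> : splice k F' F' = F' by [].
  by apply/funext => x; rewrite /splice if_same.
- move=> F _ [F' fF' nF] [a [b [fa fb -> nab]]].
  exists [set x | F' x <> a x], [set x | F' x <> b x]; split.
  + exact: (fin_supp2 (fun m n => m <> n)).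
  + exact: (fin_supp2 (fun m n => m <> n)).
  + move=> x /= abx; have [F'a|] := pselect (F' x = a x); last by left.
    by right=> F'b; apply: abx; rewrite !fctE -F'a -F'b subrr.
  + apply: (nullS idN) (nullU idN nF nab) => x [/= F'a xk].
    have [Fx|] := pselect (F x - F' x = 0); last by left.
    by right; rewrite /splice !fctE xk; lia.
  + apply: (nullS idN) (nullU idN nF nab) => x [/= F'b /negPf xk].
    have [Fx|] := pselect (F x - F' x = 0); last by left.
    by right; rewrite /splice !fctE xk; lia.
- move=> F [F' fF' nF] nF_lt.
  pose c e := F' \o update k e.
  have fc e : fin_supp (below lt k) (c e).
    apply: fin_suppS (fin_supp_update k e fF') => i [[//|->]] /=; exact.
  have F'E : splice k (c true) (c false) = F'.
    apply/funext => x; rewrite /splice /c /=.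
    by case xk: (x k); congr F'; apply/funext => i; rewrite /update; case: eqP => // ->.
  exists (c true - c false); split.
  + by exists (c true), (c false); rewrite F'E.
  + exact: fin_suppB.
  + move=> [B [C [fB fC sBC nB nC]]]; apply: nF_lt.
    exists (fun x => if `[< C x >] then c true x else c false x).
      exact: (fin_supp2 (fun (p : Prop) (mn : int * int) =>
        if `[< p >] then mn.1 else mn.2) fC (fin_supp2 pair (fc true) (fc false))).
    apply: (nullS idN) (nullU idN nF (nullU idN nB nC)) => x /=.
    have [F'x|] := pselect (F x - F' x = 0); last by left.
    rewrite !fctE -F'E /splice in F'x * => Fx; right.
    have [Cx|Cx] := pselect (C x); rewrite ?(asboolT Cx) ?(asboolF Cx) in Fx;
      case: ifPn F'x => xk F'x; try lia.
      by right.
    by left; split=> //; have [|//|//] := sBC x; rewrite /= !fctE; lia.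
Qed.

(** Modulo N, the piece at [None] consists of the constant functions and the
    piece at [Some k] of the functions that depend on k and on earlier
    coordinates only. *)
Lemma Zfiltered_fin_supp P N :
  (forall i k, lt i k -> P k -> P i) ->
  (forall k, P k -> forall N', null_ideal N' ->
     Zfiltered (@fin_supp I (below lt k) int) (null_fun N')) ->
  null_ideal N -> Zfiltered (@fin_supp I P int) (null_fun N).
Proof.
move=> Pdown IH idN.
have [NT|NT] := pselect (N setT).
  by apply: Zfiltered_trivial => F _; apply: (nullS idN) NT.
pose olt (i j : option I) := match i, j with
  | None, Some _ => True | Some i, Some j => lt i j | _, None => False end.
have owo : well_ordering olt.
  split=> [|[i|] [j|]] /=; last 4 first.
  - by have [?|->|?] := wo_tri wo i j; [exact: Or31|exact: Or32|exact: Or33].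
  - exact: Or33.
  - exact: Or31.
  - exact: Or32.
  have acc0 : Acc olt None by constructor=> -[].
  move=> [i|//]; elim: (wo_wf wo i) => {}i _ IHi.
  by constructor=> -[j|//] /= ji; exact: IHi.
have sP k : below lt k `<=` upto lt k by move=> i; left.
pose cst_fun : set (X -> int) := @fin_supp I set0 int.
pose HA o := if o is Some k then mod_null N (@fin_supp I (P `&` upto lt k) int)
             else mod_null N cst_fun.
pose NA o := if o is Some k then mod_null N (@fin_supp I (P `&` below lt k) int)
             else null_fun N.
have mod_nullS Q Q' : Q `<=` Q' ->
    mod_null N (@fin_supp I Q int) `<=` mod_null N (@fin_supp I Q' int).
  by move=> QQ' F [F' /(fin_suppS QQ') fF' nF]; exists F'.
have null_mod Q : null_fun N `<=` mod_null N (@fin_supp I Q int).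
  by move=> F nF; exists 0; [exact: fin_supp_cst|rewrite subr0].
apply: (@Zfiltered_sum _ _ _ _ olt HA NA) => //.
- by move=> [k|]; exact: mod_nullB.
- by move=> [k|] F nF; split=> //; exact: null_mod.
- move=> [i|] [j|] // ij F /= HF; last by split; apply: mod_nullS HF => h [].
  have ub : P `&` upto lt i `<=` P `&` below lt j.
    by move=> h [Ph ih]; split=> //; case: ih => [hi|->] //; exact: wo_trans hi ij.
  by split; apply: mod_nullS HF => // h /ub[Ph /sP].
- move=> F fF nF.
  have /(wo_min owo)[o HF omin] : exists o, HA o F.
    have [[u Fu]|[k Pk fk]] := fin_supp_upto wo fF.
      exists None; exists F; last by rewrite subrr; exact: null_fun0.
      by rewrite Fu; exact: fin_supp_cst.
    by exists (Some k), F => //; rewrite subrr; exact: null_fun0.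
  exists o; split=> //; case: o HF omin => // k HF omin [F' fF' nF'].
  have [[u Fu]|[j [Pj jk] fj]] := fin_supp_upto wo fF'.
    by apply: (omin None) => //; exists F' => //; rewrite Fu; exact: fin_supp_cst.
  apply: (omin (Some j)) => //; exists F' => //; apply: fin_suppS fj.
  by move=> i [[]].
- move=> [k|]; last first.
    unshelve eexists; last by [].
    apply: (@MkZfiltration _ _ _ unit (fun _ _ => False)
      (fun _ F n => null_fun N (F - fun=> n))).
    + by split=> [[]|[] []]; [constructor|exact: Or32].
    + move=> _ F G m n nF nG.
      suff -> : F - G - (fun=> m - n) = F - (fun=> m) - (G - fun=> n).
        exact: null_funB.
      by apply/funext => x; rewrite /= !fctE; lia.
    + move=> _ F n nF; split=> [nFn|->].
        apply: contrapT => n0; apply: NT; apply: (nullS idN) (nullU idN nF nFn) => x _ /=.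
        have [Fx|] := pselect (F x = 0); last by left.
        by right; rewrite !fctE Fx; lia.
      by rewrite -[fun=> 0]/(0 : X -> int) subr0.
    + by [].
    + move=> F [F' [s s0 F'cst] nF] nF0; exists tt, (F' (fun=> false)).
        suff <- : F' = fun=> F' (fun=> false) by [].
        by apply/funext => x; apply: F'cst => i /s0.
      move=> n0; apply: nF0; suff F'0 : F' = 0 by move: nF; rewrite F'0 subr0.
      by apply/funext => x; rewrite -[RHS]n0; apply: F'cst => i /s0.
  have [Pk|Pk] := pselect (P k).
    have -> : HA (Some k) = mod_null N (@fin_supp I (upto lt k) int).
      congr (mod_null N (@fin_supp I _ int)).
      apply/seteqP; split=> [i []//|i ik]; split=> //.
      by case: ik => [/Pdown|->]; first exact.
    have -> : NA (Some k) = mod_null N (@fin_supp I (below lt k) int).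
      congr (mod_null N (@fin_supp I _ int)).
      apply/seteqP; split=> [i []//|i ik]; split=> //.
      exact: Pdown Pk.
    by apply: Zfiltered_step => // N'; exact: IH.
  apply: Zfiltered_trivial; apply: mod_nullS => i [Pi [ik|ik]]; split=> //.
  by case: Pk; rewrite -ik.
Qed.

End Nobeling.

(** A point x of T is sent to the family of the truth values of its membership
    in the subsets of T.  A bounded function then depends on finitely many
    coordinates, namely on its level sets. *)
Lemma Zfiltered_bounded (T : Type) :
  Zfiltered [set f : T -> int | exists n : nat, forall x, (`|f x| <= n)%N] [set 0].
Proof.
pose I : choiceType := {classic (set T)}.
have [lt wo] := exists_well_ordering I.
pose pt (x : T) : I -> bool := fun A => `[< (A : set T) x >].
pose N : set (set (I -> bool)) := [set A | forall x, ~ A (pt x)].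
have idN : null_ideal N.
  split=> [x|A B AB NB x|A B NA NB x].
  - by [].
  - by move/AB/NB.
  - by case=> [/NA|/NB].
have zbelow k : forall N', null_ideal N' ->
    Zfiltered (@fin_supp I (below lt k) int) (null_fun N').
  elim: (wo_wf wo k) => {}k _ IH N' idN'.
  by apply: (Zfiltered_fin_supp wo _ IH) => // i j ij jk; exact: (wo_trans wo ij jk).
have : Zfiltered (@fin_supp I setT int) (null_fun N).
  by apply: (Zfiltered_fin_supp wo _ (fun k _ => zbelow k)).
apply: (@Zfiltered_pullback _ _ _ _ _ _ (fun f F => forall x, F (pt x) = f x)).
- by move=> f g F G Ff Gg x; rewrite !fctE Ff Gg.
- move=> _ ->; exists 0 => //; exact: null_fun0.
- by move=> _ F -> F0 x /=; rewrite F0.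
move=> f [n fn] f0.
pose lev (j : int) : I := [set x | f x = j].
pose js : seq int := [seq i%:Z - n%:Z | i <- iota 0 (n.*2.+1)].
have jsP x : f x \in js.
  apply/mapP; exists (absz (f x + n%:Z)); last by have := fn x; lia.
  by rewrite mem_iota; have := fn x; lia.
exists (fun p => \sum_(j <- js) j * (p (lev j))%:R).
have FE x : \sum_(j <- js) j * (pt x (lev j))%:R = f x.
  have jsU : uniq js by rewrite map_inj_uniq ?iota_uniq // => i j; lia.
  rewrite (bigD1_seq (f x) (jsP x) jsU) /=.
  rewrite big1 => [|j jf]; last first.
    by rewrite /pt asboolF ?mulr0 // => /= fj; rewrite fj eqxx in jf.
  by rewrite /pt asboolT ?mulr1 ?addr0.
split=> //.
  exists [seq lev j | j <- js] => // p q pq; apply: eq_big_seq => j jjs.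
  by rewrite pq //; exact: map_f.
move=> nF; apply: f0; apply/funext => x; rewrite -FE.
by apply: contrapT => /(nF x).
Qed.

(** * Groups of functions with locally constant sign on a compact space *)
Section Compactness.
Context {T : topologicalType} (cT : compact [set: T]).

Lemma compact_cluster (J : Type) (C : J -> set T) :
  (exists j : J, True) -> (forall i j, exists k, C k `<=` C i `&` C j) ->
  (forall j, C j !=set0) ->
  exists x : T, forall j (V : set T), nbhs x V -> C j `&` V !=set0.
Proof.
move=> [j0 _] dirC C0.
have FF : ProperFilter (filter_from [set: J] C).
  apply: filter_from_proper => [|j _]; last exact: C0.
  apply: filter_from_filter => [|i j _ _]; first by exists j0.
  by have [k kij] := dirC i j; exists k.
have [|x [_ clx]] := cT FF; first by exists j0.
by exists x => j V xV; apply: clx => //; exists j.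
Qed.

Lemma compact_directed_sub (J : Type) (C : J -> set T) (U : set T) :
  (exists j : J, True) -> (forall i j, exists k, C k `<=` C i `&` C j) ->
  (forall j, closed (C j)) -> open U ->
  \bigcap_(j in [set: J]) C j `<=` U -> exists j, C j `<=` U.
Proof.
move=> J0 dirC clC oU CU; apply: contrapT => nsub.
have [||x xP] := @compact_cluster J (fun j => C j `\` U) J0.
- move=> i j; have [k kij] := dirC i j; exists k => y [/kij[Ciy Cjy] nUy].
  by split.
- move=> j; apply: contrapT => nC; apply: nsub; exists j => y Cy.
  by apply: contrapT => nUy; apply: nC; exists y.
have Cx : (\bigcap_(j in [set: J]) C j) x.
  move=> j _; apply: (clC j) => V /(xP j)[y [[Cy _] Vy]]; by exists y.
have [j0 _] := J0.
have [|y [[_ nUy] Uy]] := xP j0 U; last by [].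
by apply: open_nbhs_nbhs; split=> //; exact: CU.
Qed.

End Compactness.

Section SignContinuousFunctions.
Context {T : topologicalType} (cT : compact [set: T]) {B : set T} (clB : closed B).
Context {Gam : set (T -> int)} (GamB : sub_closed Gam).
Hypothesis sgn_clopen : forall f, Gam f ->
  exists2 A, clopen A & forall x, B x -> A x <-> 0 <= f x.
Hypothesis eval_onto : forall x, B x ->
  (exists2 u, Gam u & u x = 1) \/ forall f, Gam f -> f x = 0.
Implicit Types (A C D : set T) (f g u : T -> int).

Lemma Gam0 f : Gam f -> Gam 0.
Proof. by move=> Gf; rewrite -(subrr f); exact: GamB. Qed.

Lemma GamN f : Gam f -> Gam (- f).
Proof. by move=> Gf; rewrite -sub0r; apply: GamB => //; exact: Gam0 Gf. Qed.

Lemma GamMz f (k : int) : Gam f -> Gam (f *~ k).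
Proof.
have GamMn g n : Gam g -> Gam (g *+ n).
  move=> Gg; elim: n => [|n IH]; first by rewrite mulr0n; exact: Gam0 Gg.
  by rewrite mulrS -[g *+ n]opprK; exact/GamB/GamN.
move=> Gf; case: k => n; first exact: GamMn.
by rewrite NegzE mulrNz; exact/GamN/GamMn.
Qed.

Lemma funMzE f (k : int) x : (f *~ k) x = k * f x.
Proof.
have funMnE g n : (g *+ n) x = n%:Z * g x.
  elim: n => [|n IH]; first by rewrite mulr0n mul0r.
  by rewrite mulrS fctE IH intS mulrDl mul1r.
case: k => n; first exact: funMnE.
by rewrite NegzE mulrNz -[LHS]/(- ((f *+ n.+1) x)) funMnE mulNr.
Qed.

(** Within B, the zero set of f is the intersection of the clopen sets where f and - f are
    nonnegative. *)
Lemma zero_nbhs f x : Gam f -> B x -> f x = 0 ->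
  exists2 V, nbhs x V & forall y, B y -> V y -> f y = 0.
Proof.
move=> Gf Bx fx.
have [A1 [oA1 _] A1P] := sgn_clopen Gf.
have [A2 [oA2 _] A2P] := sgn_clopen (GamN Gf).
exists (A1 `&` A2).
  apply: open_nbhs_nbhs; split; first exact: openI.
  by split; [apply/A1P|apply/A2P] => //; rewrite ?fctE fx.
by move=> y By [/A1P fy /A2P nfy]; move: (fy By) (nfy By); rewrite fctE; lia.
Qed.

Definition bounded_on C f : Prop :=
  exists n : nat, forall x, C x -> (absz (f x) <= n)%N.

Lemma bounded_on_compact C f : closed C -> C `<=` B -> Gam f ->
  (forall x, C x -> f x <> 0 ->
     exists2 A, nbhs x A & bounded_on (A `&` C) f) -> bounded_on C f.
Proof.
move=> clC CB Gf loc; apply: contrapT => unb.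
have [|m n|n|x xP] :=
  @compact_cluster T cT nat (fun n => [set x | C x /\ (n < absz (f x))%N]).
- by exists 0%N.
- exists (maxn m n) => x [Cx]; rewrite gtn_max => /andP[mf nf].
  by split.
- apply: contrapT => nC; apply: unb; exists n => x Cx.
  by rewrite leqNgt; apply/negP => nf; apply: nC; exists x.
have Cx : C x by apply: clC => V /(xP 0%N)[y [[Cy _] Vy]]; exists y.
have [fx|fx] := pselect (f x = 0).
  have [V xV V0] := zero_nbhs Gf (CB x Cx) fx.
  have [y [[Cy f0] Vy]] := xP 0%N V xV.
  by move: f0; rewrite (V0 y (CB y Cy) Vy).
have [A xA [n nP]] := loc x Cx fx.
have [y [[Cy nf] Ay]] := xP n A xA.
by move: nf; rewrite ltnNge nP.
Qed.

(** Bounding all functions of the group on a common clopen set, rather than each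
    one on its own, is what makes [deriv D] closed. *)
Definition deriv D : set T :=
  [set x | D x /\ forall A, clopen A -> A x ->
                    exists2 f, Gam f & ~ bounded_on (A `&` (B `&` D)) f].

Lemma deriv_closed D : closed D -> closed (deriv D).
Proof.
move=> clD x clx; split; first by apply: clD => V /clx[y [[Dy _] Vy]]; exists y.
move=> A cA Ax; have [|y [[Dy yP] Ay]] := clx A; last exact: yP.
by apply: open_nbhs_nbhs; split=> //; case: cA.
Qed.

Lemma bounded_off_deriv D f : closed D -> Gam f ->
  (forall x, (B `&` deriv D) x -> f x = 0) -> bounded_on (B `&` D) f.
Proof.
move=> clD Gf f0; apply: bounded_on_compact => // [|x [Bx Dx] fx].
  exact: closedI.
apply: contrapT => nloc; apply/fx/f0; split=> //; split=> // A cA Ax.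
exists f => // bA; apply: nloc; exists A => //.
by apply: open_nbhs_nbhs; split=> //; case: cA.
Qed.

(** At a point x of a compact set where u does not vanish, the function
    u(x) f - f(x) u of the group vanishes at x, hence near x, where f is
    therefore bounded in terms of u. *)
Lemma unbounded_transfer D A u : closed D -> clopen A -> Gam u ->
  (forall x, (A `&` (B `&` D)) x -> 0 < u x) ->
  bounded_on (A `&` (B `&` D)) u ->
  forall f, Gam f -> bounded_on (A `&` (B `&` D)) f.
Proof.
move=> clD [oA clA] Gu u_gt0 [n un] f Gf.
apply: bounded_on_compact => // [|x [_ []] //|x ABDx fx].
  by apply: closedI => //; exact: closedI.
have [_ [Bx _]] := ABDx; have ux := u_gt0 x ABDx.
have [|||V xV V0] := @zero_nbhs (f *~ u x - u *~ f x) x.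
- by apply: GamB; exact: GamMz.
- by [].
- by rewrite !fctE !funMzE mulrC subrr.
exists V => //; exists (absz (f x) * n)%N => y [Vy [Ay [By Dy]]].
have := V0 y By Vy; rewrite !fctE !funMzE => /eqP; rewrite subr_eq0 => /eqP.
move=> /(congr1 absz); rewrite !abszM => e.
apply: (@leq_trans (absz (u x) * absz (f y))%N).
  by rewrite leq_pmull // absz_gt0 gt_eqF.
by rewrite e leq_mul // un.
Qed.

(** Suppose that no point of the compact set has a neighbourhood on which all
    functions are bounded, and that some function does not vanish.  A function u
    positive on a clopen piece is unbounded there, hence has a point y with
    u(y) > 1; a function v with v(y) = 1 satisfies 0 < v < u on a smaller
    clopen piece.  Repeating this gives a decreasing sequence of nonempty
    compact pieces, and at a common point an infinite strictly decreasing
    sequence of positive integers. *)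
Lemma deriv_fixed D : closed D -> B `&` D `<=` deriv D ->
  forall f x, Gam f -> (B `&` D) x -> f x = 0.
Proof.
move=> clD fixD f x Gf [Bx Dx]; apply: contrapT => fx.
pose st (p : set T * (T -> int)) := [/\ clopen p.1, Gam p.2,
  exists y, (p.1 `&` (B `&` D)) y & forall y, (p.1 `&` (B `&` D)) y -> 0 < p.2 y].
have shrink A u : clopen A -> Gam u -> forall y, A y -> (B `&` D) y -> 1 < u y ->
    exists q, st q /\ forall z, (q.1 `&` (B `&` D)) z -> A z /\ q.2 z < u z.
  move=> cA Gu y Ay [By Dy] uy.
  have [[v Gv vy]|all0] := eval_onto By; last by move: uy; rewrite (all0 u Gu).
  have [A1 cA1 A1P] := sgn_clopen (GamB Gu (GamMz 2 Gv)).
  have [A2 cA2 A2P] := sgn_clopen (GamN Gv).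
  (* On this set u >= 2 v and v > 0. *)
  exists (A `&` A1 `&` ~` A2, v); split; [split=> //=|].
  - by apply: clopenI; [exact: clopenI|exact: clopenC].
  - exists y; split=> //; split; first split=> //.
      by apply/(A1P _ By); rewrite !fctE funMzE vy; lia.
    by move/(A2P _ By); rewrite fctE vy.
  - move=> z [[_ nA2] [Bz _]]; rewrite ltNge; apply/negP => vz.
    by apply: nA2; apply/(A2P _ Bz); rewrite fctE oppr_ge0.
  move=> z /= [[[Az /(A1P z) A1z] nA2z] [Bz _]]; split=> //.
  have vz : 0 < v z.
    rewrite ltNge; apply/negP => vz.
    by apply: nA2z; apply/(A2P _ Bz); rewrite fctE oppr_ge0.
  by move: (A1z Bz); rewrite !fctE funMzE; lia.
have next p : exists q, st p -> st q /\
    forall z, (q.1 `&` (B `&` D)) z -> p.1 z /\ q.2 z < p.2 z.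
  have [[cA Gu [y ABDy] u_gt0]|nst] := pselect (st p); last by exists p.
  have [_ /fixD[_ /(_ p.1 cA)]] := ABDy; have [Ay _] := ABDy.
  move=> /(_ Ay)[g Gg unb].
  have [z ABDz uz] : exists2 z, (p.1 `&` (B `&` D)) z & 1 < p.2 z.
    apply: contrapT => nbig; apply: unb.
    apply: (unbounded_transfer clD cA Gu u_gt0) => //; exists 1%N => z ABDz.
    have := u_gt0 z ABDz; have [|//] := leP (p.2 z) 1; first by lia.
    by move=> big; case: nbig; exists z.
  have [Az BDz] := ABDz; have [q qP] := shrink _ _ cA Gu z Az BDz uz.
  by exists q.
have [h hP] := choice next.
have [u Gu ux] : exists2 u, Gam u & 1 < u x.
  have [[u Gu ux]|all0] := eval_onto Bx; last by case: fx; exact: all0.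
  by exists (u *~ 2); [exact: GamMz|rewrite funMzE ux].
have [|q0 [q0st _]] := @shrink setT u _ Gu x I (conj Bx Dx) ux.
  by split; [exact: openT|exact: closedT].
pose s n := iter n h q0.
have sst n : st (s n) by elim: n => //= n IH; case: (hP _ IH).
pose C n := (s n).1 `&` (B `&` D).
have CS n : C n.+1 `<=` C n.
  by move=> z Cz; have [_ /(_ z Cz)[sz _]] := hP _ (sst n); split=> //; case: Cz.
have Cle m n : (m <= n)%N -> C n `<=` C m.
  elim: n => [|n IH]; first by rewrite leqn0 => /eqP->.
  by rewrite leq_eqVlt => /orP[/eqP->//|/IH Cnm] z /CS/Cnm.
have [y Cy] : exists y, forall n, C n y.
  apply: contrapT => nC.
  have [|m n|n||z Cz|n] := @compact_directed_sub T cT nat C set0.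
  - by exists 0%N.
  - exists (maxn m n) => z Cz; split; apply: (Cle _ (maxn m n)) => //.
      exact: leq_maxl.
    exact: leq_maxr.
  - apply: closedI; last exact: closedI.
    by have [[]] := sst n.
  - exact: open0.
  - by apply: nC; exists z => n; exact: Cz.
  - by have [_ _ [z Cz] _] := sst n => /(_ z Cz).
have dec n : (s n).2 y + n%:Z <= (s 0%N).2 y.
  elim: n => [|n IH]; first by rewrite addr0.
  by have [_ /(_ y (Cy n.+1))[_ lt_s]] := hP _ (sst n); move: IH lt_s => /=; lia.
have := dec (absz ((s 0%N).2 y)).
by have [_ _ _ /(_ y (Cy _))] := sst (absz ((s 0%N).2 y)); lia.
Qed.

(** The derivative is iterated along a well-ordering of the power set of T.  If
    every step removed a point, choosing a removed point at each step would
    embed the power set of T in T; so the iteration becomes stationary. *)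
Lemma Zfiltered_sign_continuous :
  Zfiltered Gam [set f | Gam f /\ forall x, B x -> f x = 0].
Proof.
have [lt wo] := exists_well_ordering (set T).
pose body (w : set T) (N : forall v, lt v w -> set T) :=
  deriv [set x | forall v (vw : lt v w), N v vw x].
pose N : set T -> set T := Fix (wo_wf wo) (fun=> set T) body.
pose E w : set T := \bigcap_(v in [set v | lt v w]) N v.
have NE w : N w = deriv (E w).
  rewrite /N Fix_eq; first by congr deriv; apply/funext => x; apply/propext; split.
  move=> {}w M M' MM'; rewrite /body; congr deriv.
  apply/funext => x; apply/propext; split=> Mx v vw; first by rewrite -MM'.
  by rewrite MM'.
have clE w : closed (E w).
  elim: (wo_wf wo w) => {}w _ IH; apply: closed_bigI => v vw.
  by rewrite NE; exact/deriv_closed/IH.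
have NsubE w : N w `<=` E w by rewrite NE => x [].
have EsubN v w : lt v w -> E w `<=` N v by move=> vw x; exact.
have [w0 w0P] : exists w, B `&` E w `<=` N w.
  apply: contrapT => nw.
  have /choice[g gP] w : exists x, [/\ B x, E w x & ~ N w x].
    apply: contrapT => ng; apply: nw; exists w => x [Bx Ex].
    by apply: contrapT => nN; apply: ng; exists x.
  have ginj v w : g v = g w -> v = w.
    have [_ Ev nNv] := gP v; have [_ Ew nNw] := gP w => e.
    have [vw|//|wv] := wo_tri wo v w.
      by case: nNv; rewrite e; exact: EsubN Ew.
    by case: nNw; rewrite -e; exact: EsubN Ev.
  pose R := [set x | exists2 w : set T, x = g w & ~ w x].
  have nR : ~ R (g R) by move=> RR; have [w /ginj <- /(_ RR)] := RR.
  by apply: (nR); exists R.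
apply: (@Zfiltered_sum _ _ _ _ lt
  (fun w => [set f | Gam f /\ forall x, (B `&` N w) x -> f x = 0])
  (fun w => [set f | Gam f /\ forall x, (B `&` E w) x -> f x = 0])) => //.
- move=> w f g [Gf f0] [Gg g0]; split=> [|x Nx]; first exact: GamB.
  by rewrite -[LHS]/(f x - g x) (f0 x Nx) (g0 x Nx).
- by move=> w f [Gf f0]; split; split=> // x [Bx _]; exact: f0.
- move=> v w vw f [Gf f0]; split; split=> // x [Bx].
    by move/NsubE/(EsubN _ _ vw) => Nx; exact: f0.
  by move/(EsubN _ _ vw) => Nx; exact: f0.
- move=> f Gf nf.
  have /(wo_min wo)[w [_ f0] wmin] :
      exists w, Gam f /\ forall x, (B `&` N w) x -> f x = 0.
    exists w0; split=> // x [Bx /NsubE Ex].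
    by apply: (@deriv_fixed (E w0)) => //; rewrite -NE.
  exists w; split=> // -[_ fE0].
  have [[v0 v0w]|nv] := pselect (exists v, lt v w); last first.
    by apply: nf; split=> // x Bx; apply: fE0; split=> // v vw; case: nv; exists v.
  pose U := [set y | B y -> f y = 0].
  have [||||x xP|[v vw] Nv0] := @compact_directed_sub T cT {v | lt v w}
    (fun v => B `&` N (sval v)) U°%classic.
  - by exists (exist _ v0 v0w).
  - move=> i j; have [ij|ij|ji] := wo_tri wo (sval i) (sval j).
    + by exists j => x [Bx /[dup] Nx /NsubE/(EsubN _ _ ij)].
    + by exists i => x; rewrite -ij.
    + by exists i => x [Bx /[dup] Nx /NsubE/(EsubN _ _ ji)].
  - by move=> v; rewrite NE; apply: closedI => //; exact: deriv_closed.
  - exact: open_interior.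
  - have Bx : B x by have [] := xP (exist _ v0 v0w) I.
    have [|V xV V0] := zero_nbhs Gf Bx.
      by apply: fE0; split=> // v vw; have [] := xP (exist _ v vw) I.
    by apply: filterS xV => y Vy By; exact: V0.
  apply: (wmin v vw); split=> // x Nx.
  by case: (Nx) => Bx _; exact: (interior_subset (Nv0 x Nx)).
move=> w; have := Zfiltered_bounded T.
apply: (@Zfiltered_pullback _ _ _ _ _ _ (fun f h =>
  [/\ Gam f, forall x, (B `&` N w) x -> f x = 0 &
      h = fun x => if `[< (B `&` E w) x >] then f x else 0])).
- move=> f g _ _ [Gf f0 ->] [Gg g0 ->]; split; first exact: GamB.
    by move=> x Nx; rewrite -[LHS]/(f x - g x) (f0 x Nx) (g0 x Nx).
  by apply/funext => x; rewrite !fctE; case: asboolP.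
- move=> f [Gf f0]; exists 0 => //; split=> // [x [Bx /NsubE Ex]|].
    exact: f0.
  by apply/funext => x; case: asboolP => // /f0 ->.
- by move=> f _ [Gf f0] [_ _ ->]; apply/funext => x; case: asboolP => // /f0 ->.
move=> f [Gf f0] nf; eexists; split; first by split.
  have [|n nP] := @bounded_off_deriv (E w) f (clE w) Gf; first by rewrite -NE.
  by exists n => x; case: asboolP => // /nP.
move=> h0; apply: nf; split=> // x BEx.
by have := congr1 (@^~ x) h0; rewrite /= asboolT.
Qed.

End SignContinuousFunctions.

(** * Prime ideals *)
Section PrimeIdeals.
Context {R : comNzRingType}.
Implicit Types (P Q : Spec R) (A I : set R).

Record is_ideal A : Prop := IsIdeal {
  is_ideal0 : A 0;
  is_idealD : forall x y, A x -> A y -> A (x + y);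
  is_idealM : forall a x, A x -> A (a * x) }.

Lemma ideal_of_ideal P : is_ideal (ideal_of P).
Proof.
split=> [|x y|a x]; rewrite /ideal_of /=; first exact: rpred0.
  exact: rpredD.
exact: idealMr.
Qed.

Lemma ideal_of1 P : ~ ideal_of P 1.
Proof. by rewrite /ideal_of /= idealr1. Qed.

Lemma ideal_of_prime P x y : ideal_of P (x * y) -> ideal_of P x \/ ideal_of P y.
Proof. by rewrite /ideal_of /= prime_idealrM => /orP. Qed.

Lemma ideal_of_sum P (J : eqType) (s : seq J) (F : J -> R) :
  (forall j, j \in s -> ideal_of P (F j)) -> ideal_of P (\sum_(j <- s) F j).
Proof.
move=> PF; rewrite big_seq; elim/big_ind: _ => //.
  exact: is_ideal0 (ideal_of_ideal P).
exact: is_idealD (ideal_of_ideal P).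
Qed.

Lemma prime_idealP A : is_ideal A -> ~ A 1 ->
  (forall x y, A (x * y) -> A x \/ A y) -> exists P, ideal_of P = A.
Proof.
move=> idA A1 primeA; pose S : {pred R} := [pred x | `[< A x >]].
have S1 : idealr_closed S.
  split=> [||a x y /asboolP Ax /asboolP Ay]; first exact/asboolP/(is_ideal0 idA).
    by apply/negP => /asboolP.
  by apply/asboolP/(is_idealD idA) => //; exact: (is_idealM idA).
have S2 : prime_idealr_closed S.
  by move=> x y /asboolP /primeA[Ax|Ay]; apply/orP; [left|right]; apply/asboolP.
pose P : prime_idealr R := HB.pack (S : R -> bool)
  (isIdealr.Build R S S1) (isPrimeIdealrClosed.Build R S S2).
exists P; apply/funext => x; apply/propext.
by split=> [/asboolP|Ax]; last exact/asboolP.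
Qed.

(** The empty chain has the empty set as its union, so Zorn's lemma is applied
    to sets that contain I unless they are empty. *)
Lemma prime_ideal_above I : is_ideal I -> ~ I 1 -> exists P, I `<=` ideal_of P.
Proof.
move=> idI I1.
pose good A := [/\ forall x y, A x -> A y -> A (x + y),
  forall a x, A x -> A (a * x), ~ A 1 & A !=set0 -> I `<=` A].
have [|M [[MD MM M1 IM] Mmax]] := @Zorn_bigcup R good.
  move=> F Fgood Fchain; split.
  - move=> x y [A FA Ax] [B FB By].
    have [AB|BA] := Fchain A B FA FB.
      by have [AD _ _ _] := Fgood B FB; exists B => //; apply: AD => //; exact: AB.
    by have [AD _ _ _] := Fgood A FA; exists A => //; apply: AD => //; exact: BA.
  - by move=> a x [A FA Ax]; exists A => //; have [_ AM _ _] := Fgood A FA; exact: AM.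
  - by move=> [A FA A1]; have [] := Fgood A FA.
  - move=> [x [A FA Ax]] y Iy; exists A => //.
    by have [_ _ _] := Fgood A FA; apply=> //; exists x.
have M0 : M !=set0.
  apply: contrapT => M0; apply: (Mmax I).
    split=> [x Mx|IM0]; first by case: M0; exists x.
    by case: M0; exists 0; apply/IM0/(is_ideal0 idI).
  by split; [exact: is_idealD idI|exact: is_idealM idI|exact: I1|move=> _ x Ix].
have {}IM := IM M0.
have idM : is_ideal M by split=> //; apply/IM/(is_ideal0 idI).
have [|P PM] := @prime_idealP M idM M1; last by exists P; rewrite PM.
move=> x y Mxy; apply: contrapT => /not_orP[Mx My].
pose M' := [set z | exists2 m, M m & exists a, z = m + a * x].
apply: (Mmax M').
  split=> [m Mm|M'M]; first by exists m => //; exists 0; rewrite mul0r addr0.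
  by apply/Mx/M'M; exists 0; [exact: is_ideal0 idM|exists 1; rewrite mul1r add0r].
split.
- move=> _ _ [m Mm [a ->]] [n Mn [b ->]]; exists (m + n); first exact: MD.
  by exists (a + b); rewrite mulrDl addrACA.
- move=> c _ [m Mm [a ->]]; exists (c * m); first exact: MM.
  by exists (c * a); rewrite mulrDr mulrA.
- move=> [m Mm [a e]]; apply: My; rewrite -[y]mul1r e mulrDl.
  by apply: MD; [rewrite mulrC; exact: MM|rewrite -mulrA; exact: MM].
- by move=> _ z /IM Mz; exists z => //; exists 0; rewrite mul0r addr0.
Qed.

Lemma ideal_gen_mem (s : seq R) a : a \in s -> ideal_gen s a.
Proof.
move=> sa; have ias : (index a s < size s)%N by rewrite index_mem.
exists (fun i => (i == Ordinal ias)%:R).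
rewrite (bigD1 (Ordinal ias)) //= eqxx mul1r nth_index // big1 ?addr0 // => i /negPf->.
by rewrite mul0r.
Qed.

Lemma ideal_gen_sub (s : seq R) P :
  (forall a, a \in s -> ideal_of P a) -> ideal_gen s `<=` ideal_of P.
Proof.
move=> sP _ [c ->]; apply: ideal_of_sum => i _.
by apply: (is_idealM (ideal_of_ideal P)); apply/sP/mem_nth.
Qed.

(** A basic neighbourhood of P in the inverse topology consists of the primes
    that contain finitely many finitely generated ideals; s collects the
    generators of these ideals. *)
Lemma inverse_closed_sep (Y : set (Spec R)) P :
  closed (Y : set (inverse_topology R)) -> ~ Y P ->
  exists2 s : seq R, forall a, a \in s -> ideal_of P a &
    forall Q, Y Q -> exists2 a, a \in s & ~ ideal_of Q a.
Proof.
move=> /closed_openC[O Osub OY] YP.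
have : (~` Y) P by [].
rewrite -OY => -[A OA]; have [F Ffg FA] := Osub A OA; rewrite -FA => PA.
have /choice[g gP] (i : set R) : exists s : seq R, i \in F -> i = ideal_gen s.
  have [iF|_] := boolP (i \in F); last by exists [::].
  by have /set_mem[s ->] := Ffg i iF; exists s.
exists (flatten [seq g i | i <- F]) => [a /flatten_mapP[i iF ai]|Q YQ].
  have FP : forall i, i \in F -> i `<=` ideal_of P := PA.
  by apply: (FP i iF); rewrite (gP i iF); exact: ideal_gen_mem.
apply: contrapT => nQ; suff : (~` Y) Q by [].
rewrite -OY; exists A => //.
suff FQ i : i \in F -> i `<=` ideal_of Q by rewrite -FA; exact: FQ.
move=> iF; rewrite (gP i iF); apply: ideal_gen_sub => a ai.
by apply: contrapT => nQa; apply: nQ; exists a => //; apply/flatten_mapP; exists i.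
Qed.

End PrimeIdeals.

(** * The ultrafilter topology on the spectrum *)
Section UltrafilterTopology.
Context {R : comNzRingType}.

Definition ultra_limit (U : set_system (Spec R)) (P : Spec R) : Prop :=
  forall x, ideal_of P x <-> U [set Q | ideal_of Q x].

Lemma ultra_limit_exists (U : set_system (Spec R)) :
  UltraFilter U -> exists P, ultra_limit U P.
Proof.
move=> UU; have PU : ProperFilter U := @ultra_proper _ _ UU.
pose A : set R := [set x | U [set Q | ideal_of Q x]].
have [||x y Axy|P PA] := @prime_idealP R A.
- split=> [|x y Ax Ay|a x]; rewrite /A /=.
  + by apply: filterS filterT => Q _; exact: is_ideal0 (ideal_of_ideal Q).
  + by apply: filterS2 Ax Ay => Q Qx Qy; exact: (is_idealD (ideal_of_ideal Q) Qx Qy).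
  + by apply: filterS => Q Qx; exact: (is_idealM (ideal_of_ideal Q) a Qx).
- move=> A1; case: (@filter_not_empty _ U PU).
  by apply: filterS A1 => Q /ideal_of1.
- have [Ux|Ux] := in_ultra_setVsetC [set Q | ideal_of Q x] UU; first by left.
  by right; apply: filterS2 Axy Ux => Q /ideal_of_prime[].
- by exists P => x; rewrite PA.
Qed.

(** The spectrum with its ultrafilter topology, which is the constructible
    topology; this presentation makes compactness immediate. *)
Definition ultra_spec : Type := Spec R.

End UltrafilterTopology.
Arguments ultra_spec : clear implicits.

HB.instance Definition _ (R : comNzRingType) := Choice.on (ultra_spec R).

Section UltraOpen.
Context {R : comNzRingType}.

Definition ultra_open (A : set (ultra_spec R)) : Prop :=
  forall U P, UltraFilter U -> ultra_limit U P -> A P -> U A.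

Lemma ultra_openT : ultra_open setT.
Proof. by move=> U P UU _ _; exact: filterT. Qed.

Lemma ultra_openI A B : ultra_open A -> ultra_open B -> ultra_open (A `&` B).
Proof.
move=> oA oB U P UU UP [AP BP].
by apply: filterI; [exact: oA AP|exact: oB BP].
Qed.

Lemma ultra_open_bigcup (J : Type) (F : J -> set (ultra_spec R)) :
  (forall j, ultra_open (F j)) -> ultra_open (\bigcup_j F j).
Proof.
move=> oF U P UU UP [j _ FP]; apply: filterS (oF j U P UU UP FP) => Q FQ.
by exists j.
Qed.

End UltraOpen.

HB.instance Definition _ (R : comNzRingType) :=
  isOpenTopological.Build (ultra_spec R)
    (@ultra_openT R) (@ultra_openI R) (@ultra_open_bigcup R).

Section UltraCompact.
Context {R : comNzRingType}.
Implicit Types A B : set (ultra_spec R).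

Lemma ultra_openE A : open A = ultra_open A.
Proof. by []. Qed.

Lemma ultra_spec_compact : compact [set: ultra_spec R].
Proof.
rewrite compact_ultra => U UU _; have [P UP] := ultra_limit_exists UU.
exists P; split=> // A; rewrite nbhsE => -[B [oB BP] BA].
by apply: filterS BA _; exact: oB UP BP.
Qed.

(** Membership in A passes to ultrafilter limits and back: a form of clopenness
    that behaves well under Boolean operations. *)
Definition decided A : Prop :=
  forall U P, UltraFilter U -> ultra_limit U P -> A P <-> U A.

Lemma decided_mem x : decided [set P | ideal_of P x].
Proof. by move=> U P _ /(_ x). Qed.

Lemma decidedC A : decided A -> decided (~` A).
Proof.
move=> dA U P UU UP; split=> [nAP|UnA AP].
  by have [/dA|] := in_ultra_setVsetC A UU; first by move/(_ P UP).
have UA : U A by apply/(dA U P).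
case: (@filter_not_empty _ U (@ultra_proper _ _ UU)).
by apply: filterS2 UA UnA => Q AQ nAQ.
Qed.

Lemma decidedI A B : decided A -> decided B -> decided (A `&` B).
Proof.
move=> dA dB U P UU UP; split=> [[/(dA U P UU UP) UA /(dB U P UU UP)] UB|UAB].
  exact: filterI.
by split; [apply/(dA U P UU UP)|apply/(dB U P UU UP)]; apply: filterS UAB => Q [].
Qed.

Lemma decided_all (J : eqType) (s : seq J) (F : J -> set (ultra_spec R)) :
  (forall j, decided (F j)) ->
  decided [set P | forall j, j \in s -> F j P].
Proof.
move=> dF; elim: s => [|j s IH].
  have -> : [set P | forall j, j \in [::] -> F j P] = setT.
    by apply/seteqP; split=> // P _ j.
  by move=> U P UU _; split=> // _; exact: filterT.
suff -> : [set P | forall i, i \in j :: s -> F i P] =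
  F j `&` [set P | forall i, i \in s -> F i P] by exact: decidedI.
apply/seteqP; split=> [P FP|P [FjP FP] i]; first split=> [|i si].
- by apply: FP; rewrite inE eqxx.
- by apply: FP; rewrite inE si orbT.
- by rewrite inE => /orP[/eqP->|/FP].
Qed.

Lemma decided_clopen A : decided A -> clopen A.
Proof.
move=> dA; split; last rewrite -openC; rewrite ultra_openE => U P UU UP.
  by move/(dA U P UU UP).
by move/(decidedC dA UU UP).
Qed.

Lemma inverse_closed_ultra_closed (Y : set (Spec R)) :
  closed (Y : set (inverse_topology R)) -> closed (Y : set (ultra_spec R)).
Proof.
move=> clY; rewrite -openC ultra_openE => U P UU UP YP.
have [s sP sY] := inverse_closed_sep clY YP.
have [UY|//] := in_ultra_setVsetC (Y : set (Spec R)) UU.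
have /(_ U P UU UP)[+ _] := @decided_all _ s (fun a => [set Q | ideal_of Q a]) decided_mem.
move=> /(_ sP) Us; exfalso; case: (@filter_not_empty _ U (@ultra_proper _ _ UU)).
by apply: filterS2 UY Us => Q YQ sQ; have [a /sQ] := sY Q YQ.
Qed.

End UltraCompact.

(** * Localizations of a Prüfer domain *)
Section Localization.
Context {D : idomainType}.
Local Notation K := {fraction D}.
Local Notation "x %:F" := (FracField.tofrac x).
Implicit Types (P Q : Spec D) (x y z : K) (J : set K).

Lemma fractionP x : exists a b : D, b != 0 /\ x = a%:F / b%:F.
Proof.
elim/quotW: x => r; have d0 := denom_ratioP r.
exists (frac r).1, (frac r).2; split=> //.
apply: (canRL (mulfK _)); first by rewrite tofrac_eq0.
unlock FracField.tofrac; rewrite -[LHS]FracField.pi_mul.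
apply/eqmodP; rewrite /= FracField.equivfE /FracField.mulf.
by rewrite !numden_Ratio ?mulr1 ?oner_neq0 // mulrC.
Qed.

Definition locring P : set K :=
  [set x | exists s a : D, ~ ideal_of P s /\ s%:F * x = a%:F].

Definition locmax P : set K :=
  [set x | exists s a : D, [/\ ~ ideal_of P s, ideal_of P a & s%:F * x = a%:F]].

Lemma not_ideal_ofM P s t : ~ ideal_of P s -> ~ ideal_of P t -> ~ ideal_of P (s * t).
Proof. by move=> Ps Pt /ideal_of_prime[]. Qed.

Lemma not_ideal_of_neq0 P s : ~ ideal_of P s -> s%:F != 0.
Proof.
move=> Ps; rewrite tofrac_eq0; apply/eqP => s0; apply: Ps; rewrite s0.
exact: is_ideal0 (ideal_of_ideal P).
Qed.

Lemma locring_base P a : locring P a%:F.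
Proof. by exists 1, a; rewrite tofrac1 mul1r; split=> //; exact: ideal_of1. Qed.

Lemma locring1 P : locring P 1.
Proof. by rewrite -tofrac1; exact: locring_base. Qed.

Lemma locringD P x y : locring P x -> locring P y -> locring P (x + y).
Proof.
move=> [s [a [Ps sx]]] [t [b [Pt ty]]].
exists (s * t), (t * a + s * b); split; first exact: not_ideal_ofM.
by rewrite tofracD !tofracM mulrDr -sx -ty mulrA [t%:F * s%:F]mulrC mulrA.
Qed.

Lemma locringM P x y : locring P x -> locring P y -> locring P (x * y).
Proof.
move=> [s [a [Ps sx]]] [t [b [Pt ty]]].
exists (s * t), (a * b); split; first exact: not_ideal_ofM.
by rewrite !tofracM mulrACA sx ty.
Qed.

Lemma locring_inv P s : ~ ideal_of P s -> locring P (s%:F)^-1.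
Proof.
move=> Ps; exists s, 1; split=> //.
by rewrite tofrac1 divff // (not_ideal_of_neq0 Ps).
Qed.

Lemma locmax_base P a : locmax P a%:F <-> ideal_of P a.
Proof.
split=> [[s [b [Ps Pb]]]|Pa]; last first.
  by exists 1, a; split; [exact: ideal_of1|by []|rewrite tofrac1 mul1r].
rewrite -tofracM => /eqP; rewrite tofrac_eq => /eqP e.
by move: Pb; rewrite -e => /ideal_of_prime[].
Qed.

Lemma locmax0 P : locmax P 0.
Proof. by rewrite -(tofrac0 D); apply/locmax_base; exact: is_ideal0 (ideal_of_ideal P). Qed.

Lemma locring0 P : locring P 0.
Proof. by rewrite -(tofrac0 D); exact: locring_base. Qed.

Lemma locring_sub P Q : ideal_of P `<=` ideal_of Q -> locring Q `<=` locring P.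
Proof. by move=> PQ x [s [a [Qs sx]]]; exists s, a; split=> // /PQ. Qed.

Lemma locmax_locring P : locmax P `<=` locring P.
Proof. by move=> x [s [a [Ps _ sx]]]; exists s, a. Qed.

Lemma locmax1 P : ~ locmax P 1.
Proof. by rewrite -tofrac1 => /locmax_base/ideal_of1. Qed.

Lemma locmaxM P x y : locring P x -> locmax P y -> locmax P (x * y).
Proof.
move=> [s [a [Ps sx]]] [t [b [Pt Pb ty]]].
exists (s * t), (a * b); split; first exact: not_ideal_ofM.
  exact: (is_idealM (ideal_of_ideal P)).
by rewrite !tofracM mulrACA sx ty.
Qed.

Lemma locring_inv_notmax P x : x != 0 -> locmax P x -> ~ locring P x^-1.
Proof.
by move=> x0 Px Pxv; apply: (@locmax1 P); rewrite -(mulVf x0); exact: locmaxM.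
Qed.

Lemma locring_unit P x : locring P x -> ~ locmax P x -> locring P x^-1.
Proof.
move=> [s [a [Ps sx]]] nPx.
have Pa : ~ ideal_of P a by move=> Pa; apply: nPx; exists s, a.
have x0 : x != 0.
  by apply: contra_not_neq nPx => ->; exact: locmax0.
by exists a, s; split=> //; rewrite -sx mulfK.
Qed.

Hypothesis pr : prufer D.

(** For x = a / b, the equation writes 1 as an element of the product of the
    fractional ideal (1, x) with its inverse. *)
Lemma prufer_split x : exists y1 y2 z1 z2 : D,
  [/\ y1 + z2 = 1, y1%:F * x = z1%:F & y2%:F * x = z2%:F].
Proof.
have [a [b [b0 ->]]] := fractionP x.
have bF : b%:F != 0 :> K by rewrite tofrac_eq0.
pose I := ideal_gen [:: b; a].
have [||fI [J' [[J'0 J'D J'Z] _] IJ']] := pr (I := I).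
- by exists [:: b; a].
- move=> I0; have : I b by apply: ideal_gen_mem; rewrite inE eqxx.
  by rewrite I0 => /eqP; rewrite (negPf b0).
have Ib : ([set c%:F | c in I]) b%:F.
  by exists b => //; apply: ideal_gen_mem; rewrite inE eqxx.
have Ia : ([set c%:F | c in I]) a%:F.
  by exists a => //; apply: ideal_gen_mem; rewrite !inE eqxx orbT.
have JD y c : J' y -> ([set c%:F | c in I]) c -> base_ring (c * y).
  by move=> J'y Ic; rewrite -IJ'; exact: prod_ideal_mem.
have [Y1 [Y2 [J'Y1 J'Y2 e]]] : exists Y1 Y2,
    [/\ J' Y1, J' Y2 & 1 = b%:F * Y1 + a%:F * Y2].
  have := @base_ring1 D; rewrite -IJ'; move: (1 : K).
  apply: prod_ideal_sub.
  - by exists 0, 0; rewrite !mulr0 addr0.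
  - move=> _ _ [Y1 [Y2 [? ? ->]]] [Z1 [Z2 [? ? ->]]]; exists (Y1 + Z1), (Y2 + Z2).
    by split; [exact: J'D|exact: J'D|rewrite !mulrDr addrACA].
  move=> _ Y [_ [c ->] <-] J'Y.
  exists ((c ord0)%:F * Y), ((c (fintype.lift ord0 ord0))%:F * Y).
  split; [exact: J'Z|exact: J'Z|].
  rewrite !big_ord_recl big_ord0 /= addr0 tofracD !tofracM mulrDl.
  by rewrite ![_ * b%:F]mulrC ![_ * a%:F]mulrC !mulrA.
have [y1 _ y1E] := JD _ _ J'Y1 Ib; have [y2 _ y2E] := JD _ _ J'Y2 Ib.
have [z1 _ z1E] := JD _ _ J'Y1 Ia; have [z2 _ z2E] := JD _ _ J'Y2 Ia.
exists y1, y2, z1, z2; split.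
- by apply/eqP; rewrite -tofrac_eq tofracD tofrac1 y1E z2E e.
- by rewrite y1E z1E [LHS]mulrC mulrA divfK.
- by rewrite y2E z2E [LHS]mulrC mulrA divfK.
Qed.

(** The elements y1 and y2 generate the ideal of the denominators of x, because
    s = s y1 + (s x) y2 whenever s x is in D. *)
Lemma locring_colon P x (y1 y2 z1 z2 : D) :
  y1 + z2 = 1 -> y1%:F * x = z1%:F -> y2%:F * x = z2%:F ->
  locring P x <-> ~ (ideal_of P y1 /\ ideal_of P y2).
Proof.
move=> e e1 e2; split=> [Px [Py1 Py2]|/not_andP[Py1|Py2]]; last 2 first.
- by exists y1, z1.
- by exists y2, z2.
apply: (@ideal_of1 _ P); rewrite -e; apply: (is_idealD (ideal_of_ideal P)) => //.
by apply/locmax_base; rewrite -e2 mulrC; apply: locmaxM => //; exact/locmax_base.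
Qed.

Lemma locring_valuation P x : ~ locring P x -> locmax P x^-1.
Proof.
have [y1 [y2 [z1 [z2 [e e1 e2]]]]] := prufer_split x => nPx.
have [Py1 Py2] : ideal_of P y1 /\ ideal_of P y2.
  by apply: contrapT; rewrite -(locring_colon P e e1 e2).
have Pz2 : ~ ideal_of P z2.
  by move=> Pz2; apply: (@ideal_of1 _ P); rewrite -e; exact: (is_idealD (ideal_of_ideal P)).
have x0 : x != 0 by apply: contra_not_neq nPx => ->; exact: locring0.
by exists z2, y2; split=> //; rewrite -e2 mulfK.
Qed.

Lemma decided_locring x : decided [set P | locring P x].
Proof.
have [y1 [y2 [z1 [z2 [e e1 e2]]]]] := prufer_split x.
have -> : [set P | locring P x] =
    ~` ([set P | ideal_of P y1] `&` [set P | ideal_of P y2]).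
  by apply/seteqP; split=> P /(locring_colon P e e1 e2).
by apply: decidedC; apply: decidedI; exact: decided_mem.
Qed.

(** An element p of P outside the square of P generates the maximal ideal of the
    localization at P.  Otherwise p is a product of two elements x and p / x of
    this maximal ideal.  At every prime M above P both of them lie in the
    localization of P at M, because D_M is a valuation ring contained in D_P;
    so p lies in the square of P locally everywhere, hence in the square. *)
Lemma locmax_generator P : ideal_of P <> prod_ideal (ideal_of P) (ideal_of P) ->
  exists p : D, [/\ ideal_of P p, p != 0 & forall x, locmax P x -> locring P (x / p%:F)].
Proof.
move=> PP2; have idP := ideal_of_ideal P.
pose P2 := prod_ideal (ideal_of P) (ideal_of P).
have P2sub : P2 `<=` ideal_of P.
  by move=> _ [s sP ->]; apply: ideal_of_sum => q /sP[_]; exact: is_idealM.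
have P2mem a b : ideal_of P a -> ideal_of P b -> P2 (a * b).
  move=> Pa Pb; exists [:: (a, b)]; last by rewrite big_seq1.
  by move=> q; rewrite inE => /eqP->.
have idP2 : is_ideal P2.
  split; first by exists [::]; rewrite ?big_nil.
  - move=> _ _ [s sP ->] [t tP ->]; exists (s ++ t); last by rewrite big_cat.
    by move=> q; rewrite mem_cat => /orP[/sP|/tP].
  - move=> a _ [s sP ->]; exists [seq (a * q.1, q.2) | q <- s].
      by move=> _ /mapP[q /sP[q1 q2] ->]; split=> //; exact: is_idealM.
    by rewrite big_map big_distrr; apply: eq_bigr => q _ /=; rewrite mulrA.
have [p Pp P2p] : exists2 p, ideal_of P p & ~ P2 p.
  apply: contrapT => np; apply: PP2; apply/seteqP; split=> // p Pp.
  by apply: contrapT => P2p; apply: np; exists p.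
have p0 : p != 0 by apply: contra_not_neq P2p => ->; exact: is_ideal0.
have pF : p%:F != 0 :> K by rewrite tofrac_eq0.
exists p; split=> // x Px; apply: contrapT => nxp; apply: P2p.
have x0 : x != 0 by apply: contra_not_neq nxp => ->; rewrite mul0r; exact: locring0.
have := locring_valuation nxp; rewrite invf_div => Ppx.
pose I := [set t | P2 (t * p)].
have idI : is_ideal I.
  split=> [|s t Is It|a t It]; rewrite /I /=; first by rewrite mul0r; exact: is_ideal0.
    by rewrite mulrDl; exact: is_idealD.
  by rewrite -mulrA; exact: is_idealM.
apply: contrapT => P2p; have [|M IM] := prime_ideal_above idI.
  by rewrite /I /= mul1r.
have PM : ideal_of P `<=` ideal_of M.
  move=> a Pa; have /IM/ideal_of_prime[]// : I (a * a).
  by rewrite /I /= -mulrA mulrC; apply: P2mem => //; rewrite mulrC; exact: is_idealM.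
have num y : locmax P y -> exists s a,
    [/\ ~ ideal_of M s, ideal_of P a & s%:F * y = a%:F].
  move=> Py; have [s [a [Ms sa]]] : locring M y.
    apply: contrapT => nMy; have y0 : y != 0.
      by apply: contra_not_neq nMy => ->; exact: locring0.
    apply: (locring_inv_notmax y0 Py); apply: (locring_sub PM).
    by apply: locmax_locring; exact: locring_valuation.
  exists s, a; split=> //; apply/locmax_base; rewrite -sa.
  by apply: locmaxM => //; exact: locring_base.
have [s [a [Ms Pa sa]]] := num _ Px; have [t [b [Mt Pb tb]]] := num _ Ppx.
apply: (not_ideal_ofM Ms Mt); apply: IM; rewrite /I /=.
suff -> : s * t * p = a * b by exact: P2mem.
apply/eqP; rewrite -tofrac_eq !tofracM -sa -tb mulrACA [x * _]mulrC divfK //.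
Qed.
End Localization.

(** * Local positivity of invertible ideals *)

(** The group of invertible ideals in additive notation. *)
Definition addInv (D : idomainType) : Type := Inv D.

HB.instance Definition _ (D : idomainType) := Choice.on (addInv D).
HB.instance Definition _ (D : idomainType) := GRing.isZmodule.Build (addInv D)
  (@Inv_mulA D) (@Inv_mulC D) (@Inv_mul1 D) (@Inv_mulV D).

Section LocalPositivity.
Context {D : idomainType}.
Local Notation K := {fraction D}.
Local Notation "x %:F" := (FracField.tofrac x).
Implicit Types (P Q : Spec D) (g h u : addInv D) (J : set K).

Lemma addInvD g h : inv_set (g + h) = prod_ideal (inv_set g) (inv_set h).
Proof. by []. Qed.

Lemma addInvN g : inv_set (- g) = inv_ideal (inv_set g).
Proof. by []. Qed.

Lemma addInv0 : inv_set (0 : addInv D) = base_ring.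
Proof. by []. Qed.

Lemma inv_subset_base g x y : inv_set g x -> inv_set (- g) y -> base_ring (x * y).
Proof. by rewrite addInvN mulrC => gx; exact. Qed.

(** The inclusion J D_P <= D_P says that J is nonnegative in the value group of
    the valuation ring D_P. *)
Definition pos P g : Prop := inv_set g `<=` locring P.

(** The condition J D_P = D_P. *)
Definition triv P g : Prop := pos P g /\ pos P (- g).

Lemma pos0 P : pos P 0.
Proof. by rewrite /pos addInv0 => _ [a _ <-]; exact: locring_base. Qed.

Lemma posD P g h : pos P g -> pos P h -> pos P (g + h).
Proof.
move=> Pg Ph; rewrite /pos addInvD; apply: prod_ideal_sub => [||x y gx hy].
- exact: locring0.
- exact: locringD.
- by apply: locringM; [exact: Pg|exact: Ph].
Qed.

Lemma posMn P g n : pos P g -> pos P (g *+ n).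
Proof.
move=> Pg; elim: n => [|n IH]; first exact: pos0.
by rewrite mulrS; exact: posD.
Qed.

Lemma triv_sub P : sub_closed [set g | triv P g].
Proof.
move=> g h [Pg Png] [Ph Pnh]; split; first exact: posD.
by rewrite opprB addrC; exact: posD.
Qed.

(** Since J and its inverse multiply to D, some product x y of their elements is
    a unit at P; then x generates J D_P. *)
Lemma local_unit P g : exists x y (t : D),
  [/\ inv_set g x, inv_set (- g) y, x * y = t%:F & ~ ideal_of P t].
Proof.
apply: contrapT => none; have := @base_ring1 D.
have <- : prod_ideal (inv_set (- g)) (inv_set g) = base_ring.
  exact/prod_inv_ideal/inv_setP.
suff /[apply] -[t Pt /esym/eqP] : prod_ideal (inv_set (- g)) (inv_set g) `<=`
    [set t%:F | t in ideal_of P].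
  by rewrite -tofrac1 tofrac_eq => /eqP t1; apply: (@ideal_of1 _ P); rewrite t1.
have idP := ideal_of_ideal P.
apply: prod_ideal_sub => [|_ _ [a Pa <-] [b Pb <-]|y x gy gx].
- by exists 0; rewrite ?tofrac0 //; exact: is_ideal0.
- by exists (a + b); rewrite ?tofracD //; exact: is_idealD.
have [t _ tE] := inv_subset_base gx gy; exists t; last by rewrite tE mulrC.
by apply: contrapT => Pt; apply: none; exists x, y, t.
Qed.

Lemma local_unit_factor P g x y (t : D) :
  inv_set (- g) y -> x * y = t%:F -> ~ ideal_of P t ->
  forall z, inv_set g z -> exists2 w, locring P w & z = x * w.
Proof.
move=> gy e Pt z gz; have [b _ bE] := inv_subset_base gz gy.
exists (b%:F * (t%:F)^-1).
  by apply: locringM; [exact: locring_base|exact: locring_inv].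
by rewrite mulrA bE mulrCA e mulfK // (not_ideal_of_neq0 Pt).
Qed.

Lemma pos_nonunit P g :
  (forall x, inv_set g x -> locmax P x) -> ~ pos P (- g).
Proof.
move=> gP Png; have [x [y [t [gx gy e Pt]]]] := local_unit P g.
apply: Pt; apply/locmax_base; rewrite -e mulrC; apply: locmaxM; [exact: Png|exact: gP].
Qed.

Section Prufer.
Hypothesis pr : prufer D.

Lemma pos_total P g : pos P g \/ pos P (- g).
Proof.
have [x [y [t [gx gy e Pt]]]] := local_unit P g.
have [Px|Px] := pselect (locring P x); [left=> z gz|right=> z gz].
- by have [w Pw ->] := local_unit_factor gy e Pt gz; exact: locringM.
- have [b _ bE] := inv_subset_base gx gz.
  have x0 : x != 0 by apply: contra_not_neq Px => ->; exact: locring0.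
  have -> : z = b%:F * x^-1 by rewrite bE mulrAC divff ?mul1r.
  by apply: locringM; [exact: locring_base|exact/locmax_locring/locring_valuation].
Qed.

Lemma decided_pos g : decided [set P | pos P g].
Proof.
have : prod_ideal (inv_set (- g)) (inv_set g) 1.
  rewrite (_ : prod_ideal _ _ = base_ring); first exact: base_ring1.
  exact/prod_inv_ideal/inv_setP.
move=> [s sg e].
have -> : [set P | pos P g] = [set P | forall q, q \in s -> locring P q.2].
  apply/seteqP; split=> P Pg; first by move=> q /sg[_ gq]; exact: Pg.
  move=> z gz; rewrite -[z]mulr1 e big_distrr big_seq /=.
  elim/big_ind: _ => [||q qs]; [exact: locring0|exact: locringD|].
  rewrite mulrA; apply: locringM; last exact: Pg.
  by have [gq _] := sg q qs; have [a _ <-] := inv_subset_base gz gq; exact: locring_base.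
by apply: decided_all => q; exact: decided_locring.
Qed.

End Prufer.

Lemma pos_everywhere g : (forall P, pos P g) -> inv_set g `<=` base_ring.
Proof.
move=> pg x gx; pose I := [set s : D | base_ring (s%:F * x)].
have [B0 BD BM] := @base_ring_submodule D.
have idI : is_ideal I.
  split=> [|s t Is It|a t It]; rewrite /I /=.
  - by rewrite tofrac0 mul0r.
  - by rewrite tofracD mulrDl; exact: BD.
  - by rewrite tofracM -mulrA; exact: BM.
have [I1|/(prime_ideal_above idI)[P IP]] := pselect (I 1).
  by move: I1; rewrite /I /= tofrac1 mul1r.
have [s [a [Ps sx]]] := pg P x gx.
by case: Ps; apply: IP; exists a.
Qed.

Lemma triv_everywhere g : (forall P, triv P g) -> g = 0.
Proof.
move=> tg; apply: inv_set_inj.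
have gD : inv_set g `<=` base_ring by apply: pos_everywhere => P; have [] := tg P.
have ngD : inv_set (- g) `<=` base_ring by apply: pos_everywhere => P; have [] := tg P.
apply/seteqP; split=> // x Dx; rewrite -[x]mulr1.
have [[[g0 gD' gM] _] _] := inv_setP g.
have : prod_ideal (inv_set (- g)) (inv_set g) 1.
  rewrite (_ : prod_ideal _ _ = base_ring); first exact: base_ring1.
  exact/prod_inv_ideal/inv_setP.
have [a _ <-] := Dx; move=> g1; apply: (gM); move: g1.
apply: (prod_ideal_sub g0 gD') => y z /ngD[b _ <-]; exact: gM.
Qed.

End LocalPositivity.

(** * Values of ideals on one layer of the spectrum *)
Section LayerValues.
Context {D : idomainType}.
Local Notation K := {fraction D}.
Local Notation "x %:F" := (FracField.tofrac x).
Implicit Types (P Q : Spec D) (g h u : addInv D) (J : set K).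
Hypotheses (pr : prufer D) (sd : strongly_discrete D).

Definition trivial_on (Y : set (Spec D)) : set (addInv D) :=
  [set g | forall P, Y P -> triv P g].

Lemma trivial_on_sub Y : sub_closed (trivial_on Y).
Proof. by move=> g h Yg Yh P YP; apply: triv_sub; [exact: Yg|exact: Yh]. Qed.

(** The ideal u is generated by an element p of P with P D_P = p D_P and by
    finitely many elements of P that do not all lie in any prime of Y. *)
Lemma local_uniformizer (Y : set (Spec D)) P :
  closed (Y : set (inverse_topology D)) -> ~ Y P -> ideal_of P <> [set 0] ->
  exists p u, [/\ ideal_of P p /\ p != 0,
    forall x, locmax P x -> locring P (x / p%:F),
    trivial_on Y u, inv_set u p%:F & inv_set u `<=` locmax P].
Proof.
move=> clY YP P0; have [p [Pp p0 pgen]] := locmax_generator pr (sd P0).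
have [s sP sY] := inverse_closed_sep clY YP.
have psP a : a \in p :: s -> ideal_of P a by rewrite inE => /orP[/eqP->|/sP].
have invu : invertible [set a%:F | a in ideal_gen (p :: s)].
  apply: pr; first by exists (p :: s).
  move=> I0; have : ideal_gen (p :: s) p by apply: ideal_gen_mem; rewrite inE eqxx.
  by rewrite I0 => /eqP; rewrite (negPf p0).
exists p, (MkInv invu : addInv D); split=> //.
- move=> Q YQ; have [a sa Qa] := sY Q YQ; split.
    by move=> _ [b _ <-]; exact: locring_base.
  move=> z gz; have [b _ bE] : base_ring (a%:F * z).
    apply: (inv_subset_base (g := MkInv invu)) => //.
    by exists a => //; apply: ideal_gen_mem; rewrite inE sa orbT.
  by exists a, b.
- by exists p => //; apply: ideal_gen_mem; rewrite inE eqxx.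
- by move=> _ [b Ib <-]; apply/locmax_base; exact: (ideal_gen_sub psP).
Qed.

Section AtPrime.
Context {P : Spec D} {p : D} {u : addInv D}.
Hypotheses (Pp : ideal_of P p) (p0 : p != 0).
Hypothesis pgen : forall x, locmax P x -> locring P (x / p%:F).
Hypotheses (up : inv_set u p%:F) (uP : inv_set u `<=` locmax P).

Let pF0 : p%:F != 0 :> K. Proof. by rewrite tofrac_eq0. Qed.

Lemma uniformizer_min g : pos P g -> ~ pos P (- g) -> pos P (g - u).
Proof.
move=> Pg nPg; have [x [y [t [gx gy e Pt]]]] := local_unit P g.
have Px : locmax P x.
  apply: contrapT => nPx; apply: nPg => z gz.
  have [b _ bE] := inv_subset_base gx gz.
  have x0 : x != 0 by apply: contra_not_neq nPx => ->; exact: locmax0.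
  have -> : z = b%:F * x^-1 by rewrite bE mulrAC divff ?mul1r.
  by apply: locringM; [exact: locring_base|apply: locring_unit => //; exact: Pg].
rewrite /pos addInvD; apply: prod_ideal_sub => [||z w gz uw].
- exact: locring0.
- exact: locringD.
have [z' Pz' ->] := local_unit_factor gy e Pt gz; have [b _ bE] := inv_subset_base up uw.
have -> : x * z' * w = (x / p%:F) * z' * b%:F.
  by rewrite bE [RHS]mulrACA divfK // mulrA.
by apply: locringM; [apply: locringM => //; exact: pgen|exact: locring_base].
Qed.

Lemma uniformizer_npos n : ~ pos P (- (u *+ n.+1)).
Proof.
elim: n => [|n IH]; first exact: pos_nonunit.
move=> Pn; apply: IH.
have -> : - (u *+ n.+1) = - (u *+ n.+2) + u.
  by rewrite [u *+ n.+2]mulrS opprD addrC addrA subrr add0r.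
by apply: posD => // z /uP/locmax_locring.
Qed.

(** Let Q be the set of the elements of D that are divisible by all powers of p
    in D_P.  It is a prime ideal strictly smaller than P, and if J D_P is
    contained in all powers of P D_P = p D_P, then J D_Q is contained in Q D_Q. *)
Lemma archimedean_or_smaller_prime g : pos P g ->
  (exists n : nat, pos P (u *+ n - g)) \/
  exists Q, [/\ ideal_of Q `<=` ideal_of P, ~ ideal_of P `<=` ideal_of Q &
              ~ pos Q (- g)].
Proof.
move=> Pg; have [[n Pn]|nPn] := pselect (exists n : nat, pos P (u *+ n - g)).
  by left; exists n.
right.
have [x [y [t [gx gy e Pt]]]] := local_unit P g.
have t0 := not_ideal_of_neq0 Pt.
have un n z : inv_set (u *+ n) z -> locring P (z / p%:F ^+ n).
  elim: n z => [|n IH] z.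
    by rewrite mulr0n addInv0 expr0 divr1 => -[a _ <-]; exact: locring_base.
  rewrite mulrS addInvD.
  apply: (prod_ideal_sub (T := fun z => locring P (z / p%:F ^+ n.+1))).
  - by rewrite mul0r; exact: locring0.
  - by move=> v w Pv Pw; rewrite mulrDl; exact: locringD.
  - move=> v w uv uw; rewrite exprS invfM mulrACA.
    by apply: locringM; [apply/pgen/uP|exact: IH].
have xp n : locring P (x / p%:F ^+ n).
  apply: contrapT => /(locring_valuation pr)/locmax_locring; rewrite invf_div => Pxp.
  apply: nPn; exists n; rewrite /pos addInvD; apply: prod_ideal_sub => [||z w uz gw].
  - exact: locring0.
  - exact: locringD.
  have [b _ bE] := inv_subset_base gx gw.
  have x0 : x != 0 by apply: contraNneq t0 => x0; rewrite -e x0 mul0r.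
  have -> : z * w = (z / p%:F ^+ n) * (p%:F ^+ n / x) * b%:F.
    rewrite mulrA divfK ?expf_neq0 // bE -!mulrA; congr (_ * _).
    by rewrite mulrA mulVf ?mul1r.
  apply: locringM; last exact: locring_base.
  by apply: locringM => //; exact: un.
pose A := [set a : D | forall n, locring P (a%:F / p%:F ^+ n)].
have AP : A `<=` ideal_of P.
  move=> a /(_ 1%N); rewrite expr1 => Pa; apply/locmax_base.
  by rewrite -(divfK pF0 a%:F); apply: locmaxM => //; exact/locmax_base.
have [|||Q QA] := @prime_idealP D A.
- split=> [n|a b Aa Ab n|a b Ab n].
  + by rewrite tofrac0 mul0r; exact: locring0.
  + by rewrite tofracD mulrDl; exact: locringD.
  + by rewrite tofracM -mulrA; apply: locringM => //; exact: locring_base.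
- by move/AP/ideal_of1.
- move=> a b Aab; apply: contrapT => /not_orP[/existsNP[m nam] /existsNP[n nbn]].
  have nz c k : ~ locring P (c%:F / p%:F ^+ k) -> c%:F / p%:F ^+ k != 0.
    by move=> nck; apply: contra_not_neq nck => ->; exact: locring0.
  have := locmaxM (locmax_locring (locring_valuation pr nam))
    (locring_valuation pr nbn).
  move/locring_inv_notmax; apply.
    by rewrite mulf_neq0 // invr_neq0 // nz.
  by rewrite invfM !invrK mulrACA -invfM -exprD -tofracM.
exists Q; rewrite QA; split=> //.
- move=> /(_ p Pp) /(_ 2%N).
  rewrite expr2 invfM mulrA divff // mul1r.
  by apply: locring_inv_notmax => //; exact/locmax_base.
have Ax : locmax Q x.
  have [s [a [Ps sx]]] := Pg x gx.
  have Aa n : locring P (a%:F / p%:F ^+ n).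
    by rewrite -sx -mulrA; apply: locringM => //; exact: locring_base.
  by exists s, a; split; rewrite ?QA // => /AP.
move=> Qng; have Qt : ideal_of Q t.
  by apply/locmax_base; rewrite -e mulrC; apply: locmaxM => //; exact: Qng.
by apply/Pt/AP; rewrite -QA.
Qed.

End AtPrime.
End LayerValues.

Section OneLayer.
Context {D : idomainType}.
Hypotheses (pr : prufer D) (sd : strongly_discrete D).
Context {Y Y' : set (Spec D)}.
Hypotheses (Y'Y : Y' `<=` Y).
Hypotheses (clY : closed (Y : set (inverse_topology D)))
           (clY' : closed (Y' : set (inverse_topology D)))
           (YMax : Y `\` Y' `<=` Max Y).
Implicit Types (P Q : Spec D) (g h u : addInv D).

(** Sets closed in the inverse topology are stable under generization, and a
    prime strictly below P is not maximal in Y. *)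
Lemma layer_generization P Q : Y P -> ideal_of Q `<=` ideal_of P ->
  ~ ideal_of P `<=` ideal_of Q -> Y' Q.
Proof.
move=> YP QP nPQ; have YQ : Y Q.
  apply: contrapT => /(inverse_closed_sep clY)[s sQ sY].
  by have [a /sQ/QP] := sY P YP.
apply: contrapT => nY'Q; have [_ /(_ P YP QP) PQ] := YMax (conj YQ nY'Q).
by apply: nPQ; rewrite PQ.
Qed.

(** The value of g at P is the exponent k for which g and the k-th power of the
    uniformizer agree locally at P.  It exists because g is archimedean at P,
    all primes strictly below P being in Y'. *)
Lemma layer_value P : exists v : addInv D -> int,
  (forall g h, trivial_on Y' g -> trivial_on Y' h -> v (g - h) = v g - v h) /\
  (Y P ->
    (forall g, trivial_on Y' g -> 0 <= v g <-> pos P g) /\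
    ((exists2 u, trivial_on Y' u & v u = 1) \/
     forall g, trivial_on Y' g -> v g = 0)).
Proof.
have [YP|nYP] := pselect (Y P); last first.
  by exists (fun=> 0); split=> // g h _ _; rewrite subrr.
have [Y'P|nY'P] := pselect (Y' P).
  exists (fun=> 0); split=> [g h _ _|_]; first by rewrite subrr.
  by split; [move=> g /(_ P Y'P)[]|right].
have [P0|P0] := pselect (ideal_of P = [set 0]).
  exists (fun=> 0); split=> [g h _ _|_]; first by rewrite subrr.
  split; last by right.
  move=> g _; split=> // _ x _; have [a [b [b0 ->]]] := fractionP x.
  exists b, a; split; first by rewrite P0; exact/eqP.
  by rewrite mulrC divfK // tofrac_eq0.
have [p [u [[Pp p0] pgen Hu up uP]]] := local_uniformizer pr sd clY' nY'P P0.
have nposu := uniformizer_npos uP.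
have posu : pos P u by move=> z /uP/locmax_locring.
have val_pos g : trivial_on Y' g -> pos P g -> exists k : int, triv P (g - u *~ k).
  move=> Hg Pg; have exn : exists n : nat, `[< pos P (u *+ n - g) >].
    have [[n Pn]|[Q [QP nPQ nQg]]] := archimedean_or_smaller_prime pr Pp p0 pgen uP Pg.
      by exists n; exact/asboolP.
    by case: nQg; have [] := Hg Q (layer_generization YP QP nPQ).
  case: (ex_minnP exn) => n /asboolP Pn nmin; exists n.
  split; last by rewrite opprB.
  case: n Pn nmin => [|n] Pn nmin; first by rewrite mulr0z subr0.
  have -> : g - u *~ n.+1 = (g - u *+ n) - u.
    by rewrite -[u *~ n.+1]/(u *+ n.+1) mulrSr opprD addrA.
  have nP : ~ pos P (- (g - u *+ n)).
    by rewrite opprB => /asboolP/nmin; rewrite ltnn.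
  by apply: (uniformizer_min p0 pgen up) => //; case: (pos_total pr P (g - u *+ n)).
have /choice[v vP] g : exists k : int, trivial_on Y' g -> triv P (g - u *~ k).
  have [Hg|nHg] := pselect (trivial_on Y' g); last by exists 0.
  have [Pg|Png] := pos_total pr P g.
    by have [k kP] := val_pos g Hg Pg; exists k.
  have HNg : trivial_on Y' (- g).
    by move=> Q /Hg[Qg Qng]; split=> //; rewrite opprK.
  have [k [kP nkP]] := val_pos _ HNg Png; exists (- k) => _.
  by split; [move: nkP|move: kP]; rewrite mulrNz ?opprD ?opprK.
have triv0 k : triv P (u *~ k) -> k = 0.
  by case: k => [[//|n] [_ /nposu]|n [/nposu]].
exists v; split=> [g h Hg Hh|_].
  have := triv_sub (triv_sub (vP g Hg) (vP h Hh)) (vP _ (trivial_on_sub Hg Hh)).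
  have -> : g - u *~ v g - (h - u *~ v h) - (g - h - u *~ v (g - h)) =
      u *~ (v (g - h) - v g + v h).
    have subrAC4 (x y z t : addInv D) : x - y - (z - t) = x - z - (y - t).
      by rewrite !opprB addrACA [RHS]addrACA [- z - y]addrC.
    rewrite (subrAC4 g) (subrAC4 (g - h)) subrr sub0r !mulrzDr mulrNz !opprB.
    by rewrite [RHS]addrAC addrA.
  by move/triv0 => e; lia.
split=> [g Hg|]; last first.
  left; exists u => //; have := vP u Hu; rewrite -{1}[u]mulr1z -mulrNz -mulrzDr.
  by move/triv0; lia.
have [Pgv Pngv] := vP g Hg; split=> [|Pg].
  case: (v g) Pgv => // n Pgn _; rewrite -[g](subrK (u *~ n)).
  by apply: posD => //; exact: posMn.
case: (v g) Pngv => // n; rewrite opprB => Pn; case: (nposu n).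
by have := posD Pn Pg; rewrite subrK.
Qed.

(** An ideal is sent to the function of its values, whose signs are locally
    constant because local positivity is decided by finitely many elements. *)
Lemma layer_Zfiltered : Zfiltered (trivial_on Y') (trivial_on Y).
Proof.
have /choice[v vP] := layer_value.
have vB P g h : trivial_on Y' g -> trivial_on Y' h -> v P (g - h) = v P g - v P h.
  by move=> Hg Hh; have [vPB _] := vP P; exact: vPB.
have H0 : trivial_on Y' 0 by move=> P _; split; rewrite ?oppr0; exact: pos0.
have HN g : trivial_on Y' g -> trivial_on Y' (- g).
  by rewrite -[- g]sub0r; exact: trivial_on_sub.
have vN P g : trivial_on Y' g -> v P (- g) = - v P g.
  move=> Hg; have vP0 : v P 0 = 0 by rewrite -(subrr g) vB // subrr.
  by rewrite -[- g]sub0r vB // vP0 sub0r.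
have v0 P g : Y P -> trivial_on Y' g -> triv P g <-> v P g = 0.
  move=> YP Hg; have [_ /(_ YP)[sgn _]] := vP P.
  split=> [[/(sgn _ Hg) vg /(sgn _ (HN g Hg))]|vg].
    by rewrite vN // oppr_ge0 => vg'; apply/le_anti/andP.
  by split; apply/sgn; rewrite ?vN ?vg //; exact: HN.
pose Gam : set (ultra_spec D -> int) :=
  [set f | exists2 g, trivial_on Y' g & f = v^~ g].
have GamB : sub_closed Gam.
  move=> f f' [g Hg ->] [h Hh ->]; exists (g - h); first exact: trivial_on_sub.
  by apply/funext => P; rewrite vB.
have := @Zfiltered_sign_continuous (ultra_spec D) (@ultra_spec_compact D) Y
  (inverse_closed_ultra_closed clY) Gam GamB.
have YY' : trivial_on Y `<=` trivial_on Y' by move=> g Yg P /Y'Y; exact: Yg.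
move=> zGam.
apply: (Zfiltered_pullback (phi := fun g f => trivial_on Y' g /\ f = v^~ g)) (zGam _ _).
- move=> g h _ _ [Hg ->] [Hh ->]; split; first exact: trivial_on_sub.
  by apply/funext => P; rewrite vB.
- move=> g Yg; have Hg := YY' g Yg; exists (v^~ g) => //; split; first by exists g.
  by move=> P YP; apply/(v0 P g YP Hg); exact: Yg.
- move=> g _ Yg [Hg ->]; split; first by exists g.
  by move=> P YP; apply/(v0 P g YP Hg); exact: Yg.
- move=> g Hg nYg; exists (v^~ g); split=> //; first by exists g.
  by move=> [_ vg]; apply: nYg => P YP; apply/(v0 P g YP Hg); exact: vg.
- move=> _ [g Hg ->]; exists [set P | pos P g].
    exact: (decided_clopen (decided_pos pr g)).
  by move=> P YP; have [_ /(_ YP)[sgn _]] := vP P; rewrite sgn.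
- move=> P YP; have [_ /(_ YP)[_ [[u Hu vu]|vall]]] := vP P; [left|right].
    by exists (v^~ u) => //; exists u.
  by move=> _ [g Hg ->]; exact: vall.
Qed.
End OneLayer.

(** * Freeness of the group of invertible ideals *)

Theorem theorem8p6 (D : idomainType) (hD : CSD_domain D) :
  free_abelian (Inv D).
Proof.
have [pr sd [d [W [Y lay]]]] := hD.
have wo : well_ordering (fun a b : W => (a < b)%O : Prop).
  have := strict_well_ordering (layering_wo lay).
  congr well_ordering; apply/funext => a; apply/funext => b; apply/propext.
  by rewrite lt_neqAle; split=> [[-> ->]|/andP].
have leY a b : (a <= b)%O -> Y b `<=` Y a.
  by rewrite le_eqVlt => /orP[/eqP->//|ab]; exact: (layering_decr lay ab).
have succ_ex (a b : W) : (a < b)%O -> exists s, is_succ a s.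
  move=> ab.
  have [|s as_ smin] := wo_min wo (P := fun s : W => (a < s)%O : Prop).
    by exists b.
  exists s; split=> // c ac; rewrite leNgt; apply/negP => cs; exact: smin cs ac.
have [c Yc] := layering_empty lay.
suff [z _] : @Zfiltered (addInv D) setT [set 0] by exact: (Zfiltration_free z).
(* Quantifying over all successors makes the piece at an index without
   successor the whole group; the layer there is empty. *)
apply: (@Zfiltered_sum _ _ _ W _
  (fun a => [set g | forall b, is_succ a b -> trivial_on (Y b) g])
  (fun a => trivial_on (Y a)) wo).
- by move=> a g h Hg Hh b ab; apply: trivial_on_sub; [exact: Hg|exact: Hh].
- have triv0 (P : Spec D) : triv P 0 by split; rewrite ?oppr0; exact: pos0.
  by move=> a _ ->; split=> [b _ P _|P _]; exact: triv0.
- move=> a b ab g Hg; have [s as_] := succ_ex a b ab.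
  have gb : trivial_on (Y b) g.
    by move=> P /(leY s b (as_.2 b ab)); exact: Hg.
  by split=> // e [be _] P /(leY b e (ltW be)); exact: gb.
- move=> g _ g0.
  have /(wo_min wo)[a ga amin] : exists a, trivial_on (Y a) g.
    by exists c => P; rewrite Yc.
  have na0 : ~ is_zero a.
    move=> a0; apply/g0/triv_everywhere => P; apply: ga.
    by rewrite (layering_zero lay a0).
  have [[b ba]|nsucc] := pselect (exists b, is_succ b a).
    exists b; split; last by apply: amin; case: ba.
    move=> e be; suff -> : e = a by [].
    by apply/le_anti; rewrite (be.2 a ba.1) (ba.2 e be.1).
  have Ya := layering_limit lay (conj na0 nsucc).
  exfalso.
  have [b0 b0a] : exists b, (b < a)%O.
    apply: contrapT => nb; apply: na0 => b; rewrite leNgt; apply/negP => ba.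
    by apply: nb; exists b.
  (* If a is a limit, compactness puts some earlier layer inside the open set
     where g is locally trivial, against the minimality of a. *)
  have [||||P YP|[b ba] Yb] :=
    @compact_directed_sub (ultra_spec D) (@ultra_spec_compact D)
      {b : W | (b < a)%O} (fun b => Y (sval b)) [set P | triv P g].
  - by exists (exist _ b0 b0a).
  - move=> i j; have [ij|/ltW ji] := leP (sval i) (sval j).
      by exists j => P YP; split=> //; exact: leY ij P YP.
    by exists i => P YP; split=> //; exact: leY ji P YP.
  - by move=> b; apply: inverse_closed_ultra_closed; exact: layering_closed lay _.
  - by have [] := decided_clopen (decidedI (decided_pos pr g) (decided_pos pr (- g))).
  - by apply: ga; rewrite Ya => b ba; exact: (YP (exist _ b ba)).
  - exact: (amin b ba).
move=> a; have [[b ab]|nb] := pselect (exists b, is_succ a b); last first.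
  apply: Zfiltered_trivial => g _ P YaP; exfalso.
  have [ac|ca] := ltP a c; first by apply: nb; exact: succ_ex ac.
  by have := leY c a ca P YaP; rewrite Yc.
have HaE : [set g | forall b, is_succ a b -> trivial_on (Y b) g] = trivial_on (Y b).
  apply/seteqP; split=> g Hg; first exact: Hg.
  move=> e ae; suff -> : e = b by [].
  by apply/le_anti; rewrite (ab.2 e ae.1) (ae.2 b ab.1).
rewrite HaE; apply: (layer_Zfiltered pr sd).
- exact: leY (ltW ab.1).
- exact: layering_closed lay a.
- exact: layering_closed lay b.
- move=> P YP; exact: (layering_max lay ab YP).
Qed.
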